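(* Let $(M,\mathcal{F})$ be a foliated $C^\infty$ manifold such that $\mathcal{F}$ is a $Q$-foliation. Then the De Rham cohomology $H(\mathcal{D}_{\mathcal{F}})$ of the space of leaves $M/\mathcal{F}$, endowed with the quotient diffeology $\mathcal{D}_{\mathcal{F}}$, is isomorphic to the basic cohomology $H_b(M,\mathcal{F})$ of the foliation.
   Context: A plot on a set $X$ is a map $\alpha\colon U\to X$ defined on an open subset $U$ of some $\mathbb{R}^n$, $n\ge 0$. A diffeology of class $C^\infty$ on $X$ is a family $\mathcal{D}$ of plots such that: (1) all constant plots are in $\mathcal{D}$; (2) if $\alpha\in\mathcal{D}$ has domain $U\subset\mathbb{R}^n$ and $h\colon V\subset\mathbb{R}^m\to U$ is $C^\infty$ ($V$ open), then $\alpha\circ h\in\mathcal{D}$; (3) if $\alpha\colon U\to X$ is a plot and each $t\in U$ has a neighbourhood $V\subset U$ with $\alpha|_V\in\mathcal{D}$, then $\alpha\in\mathcal{D}$. A diffeological space is a set with a diffeology. Let $(M,\mathcal{F})$ be a foliated manifold. The space of leaves $M/\mathcal{F}$ is the quotient of $M$ identifying two points iff they lie on the same leaf; $\pi\colon M\to M/\mathcal{F}$ is the projection. The quotient diffeology $\mathcal{D}_{\mathcal{F}}$ on $M/\mathcal{F}$ consists of the plots $\alpha\colon U\to M/\mathcal{F}$ such that every $t\in U$ has an open neighbourhood $V_t\subset U$ with $\alpha|_{V_t}=\pi\circ\beta_t$ for some $C^\infty$ map $\beta_t\colon V_t\to M$. For a diffeological space $(X,\mathcal{D})$, a $\mathcal{D}$-differential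 form of degree $r\ge 0$ is a family $\omega=\{\omega_\alpha\}_{\alpha\in\mathcal{D}}$, where $\omega_\alpha\in\Omega^r(U)$ is a smooth $r$-form on the domain $U$ of $\alpha$, such that $\omega_{\alpha\circ h}=h^*\omega_\alpha$ for every $\alpha\in\mathcal{D}$ with domain $U$ and every $C^\infty$ map $h\colon V\subset\mathbb{R}^m\to U$ ($V$ open). $\Omega^r(\mathcal{D})$ is the real vector space of such forms, with exterior differential $d\omega=\{d\omega_\alpha\}_{\alpha\in\mathcal{D}}$. The De Rham cohomology $H(\mathcal{D})$ is the cohomology of the complex $(\Omega(\mathcal{D}),d)$. A form $\omega\in\Omega^r(M)$ is basic if $i_X\omega=0$ and $i_Xd\omega=0$ for every vector field $X$ tangent to $\mathcal{F}$. The basic forms, with the usual exterior differential of $M$, form a complex $\Omega_b(M,\mathcal{F})$, whose cohomology is the basic cohomology $H_b(M,\mathcal{F})$. Isomorphism of cohomologies means isomorphism of graded real vector spaces, i.e. in each degree. Let $I=[0,1]$. All manifolds, maps and paths below are $C^\infty$; a path in $M$ is tangential (to $\mathcal{F}$) if its velocity is everywhere tangent to the leaves. $\mathcal{F}$ is a $Q$-foliation when it has the following $C^\infty$ tubular property: for any manifold $X$ with a base point $x$, any pair of maps $\beta,\gamma\colon X\to M$ with $\pi\circ\beta=\pi\circ\gamma$, and any tangential path $\mu\colon I\to M$ with $\mu(0)=\beta(x)$, $\mu(1)=\gamma(x)$, there exist a neighbourhood $U\subset X$ of $x$ and a differentiable homotopy $H\colon U\times I\to M$ such that: $H(y,0)=\beta(y)$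 and $H(y,1)=\gamma(y)$ for all $y\in U$; $H(x,t)=\mu(t)$ for all $t\in I$; and for every $y\in U$ the path $t\mapsto H(y,t)$ is tangential to $\mathcal{F}$. *)

(* Defs.v *)
From HB Require Import structures.
From mathcomp Require Import all_boot all_order all_algebra.
From mathcomp Require Import all_classical all_reals all_analysis.
From Stdlib Require Import Relation_Operators.

Set Implicit Arguments.
Unset Strict Implicit.
Unset Printing Implicit Defensive.

Import Order.TTheory GRing.Theory Num.Theory numFieldNormedType.Exports.
Local Open Scope ring_scope.
Local Open Scope classical_set_scope.
Local Open Scope quotient_scope.

Section Smooth.
Context {R : realType}.

Section Definitions.
Variables (n : nat) (W : normedModType R) (U : set 'rV[R]_n).

(* Class C^k on U, meant for U open *)
Fixpoint is_Ck (k : nat) (f : 'rV[R]_n -> W) : Prop :=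
  match k with
  | 0 => forall x, U x -> {for x, continuous f}
  | k'.+1 => (forall x, U x -> differentiable f x) /\ (forall v, is_Ck k' ('D_v f))
  end.

Definition smooth (f : 'rV[R]_n -> W) : Prop := forall k, is_Ck k f.

End Definitions.

Lemma differentiable_near0 (V W : normedModType R) (k : V -> W) (x : V) :
  (\forall y \near x, k y = 0) -> differentiable k x.
Proof.
move=> k0.
have kx : k x = 0 by exact: (nbhs_singleton k0).
have c0 : continuous (\0 : {linear V -> W}) by move=> y; exact: cvg_cst.
have E : k \o shift x = cst (k x) + (\0 : {linear V -> W}) +o_ 0 id.
  apply/eqaddoP => e e0; near=> h.
  rewrite !fctE /= kx addr0 subr0.
  suff -> : k (h + x) = 0 by rewrite normr0 mulr_ge0 // ltW.
  near: h; move: k0.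
  rewrite (near_shift 0 x) => k0; apply: filterS k0 => h /=.
  by rewrite subr0.
apply/diff_locallyP; rewrite (diff_unique c0 E); split => //.
Unshelve. all: by end_near. Qed.

Lemma differentiable_near_eq (V W : normedModType R) (f g : V -> W) (x : V) :
  (\forall y \near x, f y = g y) -> differentiable f x -> differentiable g x.
Proof.
move=> fg df.
have -> : g = f + (g - f) by apply/funext => y; rewrite !fctE addrC subrK.
apply: differentiableD => //; apply: differentiable_near0.
by apply: filterS fg => y fgy; rewrite !fctE fgy subrr.
Qed.

Section Euclid.
Variable n : nat.
Implicit Types (U V : set 'rV[R]_n) (W : normedModType R).

Lemma Ck_sub k W U V (f : 'rV[R]_n -> W) : V `<=` U -> is_Ck U k f -> is_Ck V k f.
Proof.
move=> VU; elim: k f => [|k IH] f /=; first by move=> H x /VU; exact: H.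
by move=> [d D]; split=> [x /VU|v]; [exact: d|exact/IH].
Qed.

Lemma Ck_ext k W U (f g : 'rV[R]_n -> W) : open U ->
  (forall x, U x -> f x = g x) -> is_Ck U k f -> is_Ck U k g.
Proof.
move=> oU; elim: k f g => [|k IH] f g fg.
  all: have fgn x : U x -> \forall y \near x, f y = g y
    by move=> Ux; apply: filterS (open_nbhs_nbhs (conj oU Ux)) => y /fg.
  move=> H x Ux; have := H x Ux; rewrite /prop_for /continuous_at -fg //.
  apply: cvg_trans; exact: (@near_eq_cvg _ _ (nbhs x) _ f g (fgn x Ux)).
move=> [d D]; split=> [x Ux|v].
  exact: differentiable_near_eq (fgn x Ux) (d x Ux).
by apply: IH (D v) => x Ux; exact/near_eq_derive/fgn.
Qed.

Lemma Ck_weak k W U (f : 'rV[R]_n -> W) : is_Ck U k.+1 f -> is_Ck U k f.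
Proof.
elim: k f => [|k IH] f.
  by move=> [d _] x Ux; exact/differentiable_continuous/d.
by move=> [d D]; split=> // v; exact: IH (D v).
Qed.

Lemma Ck_lin k W U (a : R) (f g : 'rV[R]_n -> W) : open U ->
  is_Ck U k f -> is_Ck U k g -> is_Ck U k (fun x => a *: f x + g x).
Proof.
move=> oU; elim: k f g => [|k IH] f g.
  move=> cf cg x Ux.
  exact: (cvgD (cvgZl_tmp (k := a) (cf x Ux)) (cg x Ux)).
move=> [df Df] [dg Dg]; split=> [x Ux|v].
  exact: (differentiableD (@differentiableZ _ _ _ _ a _ (df x Ux)) (dg x Ux)).
apply: (@Ck_ext _ _ _ (fun x => a *: 'D_v f x + 'D_v g x)) => //; last exact: (IH _ _ (Df v) (Dg v)).
move=> x Ux; have dfx := @diff_derivable _ _ _ _ _ v (df x Ux).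
have dgx := @diff_derivable _ _ _ _ _ v (dg x Ux).
by rewrite -(deriveZ a dfx) -(deriveD (@derivableZ _ _ _ _ a _ _ dfx) dgx).
Qed.

Lemma Ck_cst k W U (a : W) : is_Ck U k (fun _ : 'rV[R]_n => a).
Proof.
elim: k a => [|k IH] a; first by move=> x _; apply: cst_continuous; exact: nbhs_filter.
split=> [x _|v]; first exact: differentiable_cst.
suff -> : 'D_v (fun _ : 'rV[R]_n => a) = fun _ => 0 by exact: IH.
by apply/funext => x; rewrite -[LHS]/('D_v (cst a) x) derive_cst.
Qed.

Lemma Ck_sum k W U (I : finType) (f : I -> 'rV[R]_n -> W) : open U ->
  (forall i, is_Ck U k (f i)) -> is_Ck U k (fun x => \sum_i f i x).
Proof.
move=> oU Hf; rewrite (_ : (fun x => _) = \sum_i f i); last first.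
  by apply/funext => x; rewrite fct_sumE.
elim/big_ind: _ => [|g h Hg Hh|i _]; [exact: Ck_cst| |exact: Hf].
apply: Ck_ext (Ck_lin 1 oU Hg Hh) => // x _.
by rewrite scale1r.
Qed.

Lemma Ck_mul k U (f g : 'rV[R]_n -> R) : open U ->
  is_Ck U k f -> is_Ck U k g -> is_Ck U k (fun x => f x * g x).
Proof.
move=> oU; elim: k f g => [|k IH] f g.
  by move=> cf cg x Ux; exact: (cvgM (cf x Ux) (cg x Ux)).
move=> Hf Hg; have [wf wg] := (Ck_weak Hf, Ck_weak Hg).
case: Hf Hg => [df Df] [dg Dg]; split=> [x Ux|v].
  exact: (differentiableM (df x Ux) (dg x Ux)).
apply: (@Ck_ext _ _ _ (fun x => 1 *: (f x * 'D_v g x) + g x * 'D_v f x)) => //.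
  move=> x Ux; rewrite scale1r -[RHS]/('D_v (f * g) x) deriveM//.
  - exact/diff_derivable/df.
  - exact/diff_derivable/dg.
exact: (Ck_lin _ oU (IH _ _ wf (Dg v)) (IH _ _ wg (Df v))).
Qed.

Lemma Ck_coord k m U (F : 'rV[R]_n -> 'rV[R]_m) j : open U ->
  is_Ck U k F -> is_Ck U k (fun x => F x 0 j).
Proof.
move=> oU; elim: k F => [|k IH] F.
  move=> cF x Ux.
  exact: (@continuous_comp _ _ _ F (fun M : 'rV[R]_m => M 0 j) x (cF x Ux)
    (@coord_continuous _ _ _ _ _ _)).
move=> [d D]; split=> [x Ux|v].
  exact: (@differentiable_comp _ _ _ _ F (fun M : 'rV[R]_m => M 0 j) x (d x Ux)
    (differentiable_coord _ _ _)).
apply: Ck_ext (IH _ (D v)) => // x Ux.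
by rewrite (derive_mx (@diff_derivable _ _ _ _ _ v (d x Ux))) mxE.
Qed.

Lemma Ck_row k m U (F : 'rV[R]_n -> 'rV[R]_m) : open U ->
  (forall j, is_Ck U k (fun x => F x 0 j)) -> is_Ck U k F.
Proof.
move=> oU; elim: k F => [|k IH] F H.
  move=> x Ux; apply/(@cvgrPdist_le _ _ _ (nbhs x) (nbhs_filter x)) => e e0.
  near=> y.
  rewrite [leLHS]/Num.Def.normr/= mx_normrE (bigmax_le _ (ltW e0))//= => i _.
  rewrite !mxE/=; move: i; near: y; apply: filter_forall => -[i j] /=.
  rewrite (ord1 i).
  by have /(@cvgrPdist_le _ _ _ (nbhs x) (nbhs_filter x)) := H j x Ux; apply.
have dF x : U x -> differentiable F x.
  move=> Ux.
  rewrite (_ : F = \sum_j (fun x => F x 0 j *: delta_mx 0 j)); last first.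
    by apply/funext => y; rewrite fct_sumE [LHS]row_sum_delta.
  apply: differentiable_sum => j; apply: differentiableZl.
  by case: (H j) => d _; exact: d.
split=> // v; apply: IH => j.
have [_ /(_ v)] := H j; apply: Ck_ext => // x Ux.
by rewrite (derive_mx (@diff_derivable _ _ _ _ _ v (dF x Ux))) mxE.
Unshelve. all: by end_near. Qed.

End Euclid.

Lemma Ck_comp_scalar k n m (U : set 'rV[R]_m) (V : set 'rV[R]_n)
    (f : 'rV[R]_m -> R) (h : 'rV[R]_n -> 'rV[R]_m) :
  open U -> open V -> (forall x, V x -> U (h x)) ->
  is_Ck U k f -> is_Ck V k h -> is_Ck V k (f \o h).
Proof.
move=> oU oV VU; elim: k f => [|k IH] f.
  move=> cf ch x Vx; apply: continuous_comp; first exact: ch.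
  exact/cf/VU.
move=> [df Df] Hh; have wh := Ck_weak Hh; case: Hh => [dh Dh].
split=> [x Vx|v].
  exact: (differentiable_comp (dh x Vx) (df _ (VU x Vx))).
apply: (@Ck_ext _ _ _ _
  (fun x => \sum_j 'D_v h x 0 j * ('D_(delta_mx 0 j) f \o h) x)) => //.
  move=> x Vx; have dhx := dh x Vx; have dfx := df _ (VU x Vx).
  rewrite [RHS]deriveE; last exact: differentiable_comp.
  rewrite diff_comp //= -(deriveE v dhx) [in RHS](row_sum_delta ('D_v h x)).
  rewrite linear_sum; apply: eq_bigr => j _.
  by rewrite linearZ /= -(deriveE _ dfx).
apply: Ck_sum => // j.
exact: (Ck_mul oV (Ck_coord j oV (Dh v)) (IH _ (Df _) wh)).
Qed.

Lemma smooth_comp n m p (U : set 'rV[R]_m) (V : set 'rV[R]_n)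
    (f : 'rV[R]_m -> 'rV[R]_p) (h : 'rV[R]_n -> 'rV[R]_m) :
  open U -> open V -> (forall x, V x -> U (h x)) ->
  smooth U f -> smooth V h -> smooth V (f \o h).
Proof.
move=> oU oV VU sf sh k; apply: Ck_row => // j.
exact: (Ck_comp_scalar oU oV VU (Ck_coord j oU (sf k)) (sh k)).
Qed.

End Smooth.

Section LinearAlgebra.
Context {R : realType}.

Record subspace (V : lmodType R) := Subspace {
  subspace_set :> V -> Prop;
  subspace0 : subspace_set 0;
  subspaceP : forall (a : R) u v,
    subspace_set u -> subspace_set v -> subspace_set (a *: u + v) }.

Section SubspaceType.
Variables (V : lmodType R) (S : subspace V).

Record subspace_type := SubspaceElt {
  subspace_val :> V; subspace_valP : subspace_val \in (subspace_set S : set V) }.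

HB.instance Definition _ := [isSub for subspace_val].
HB.instance Definition _ := [Choice of subspace_type by <:].

Lemma subspace_submod_closed : submod_closed (mem (subspace_set S : set V)).
Proof.
split; first by rewrite inE; exact: subspace0.
by move=> a u v; rewrite !inE; exact: subspaceP.
Qed.

HB.instance Definition _ :=
  GRing.SubChoice_isSubLmodule.Build R V (mem (subspace_set S : set V)) subspace_type
    subspace_submod_closed.

End SubspaceType.

Section QuotientSpace.
Variables (V : lmodType R) (S : subspace V).

Definition quotient_rel (u v : V) : bool := `[< S (u - v) >].

Let subspaceN u : S u -> S (- u).
Proof.
by move=> Su; rewrite -[- u]addr0 -scaleN1r; exact: subspaceP (subspace0 S).
Qed.

Let subspaceD u v : S u -> S v -> S (u + v).
Proof. by move=> Su Sv; rewrite -[u]scale1r; exact: subspaceP. Qed.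

Lemma quotient_rel_equiv : equiv_class_of quotient_rel.
Proof.
split=> [u|u v|v u w].
- by apply/asboolP; rewrite subrr; exact: subspace0.
- by apply/asboolP/asboolP => /subspaceN; rewrite opprB.
- move=> /asboolP uv /asboolP vw; apply/asboolP.
  by rewrite -(subrKA v); exact: subspaceD.
Qed.

Canonical quotient_equiv := EquivRelPack quotient_rel_equiv.

Definition quotient_space := {eq_quot quotient_equiv}.
HB.instance Definition _ := Choice.on quotient_space.
HB.instance Definition _ := EqQuotient.on quotient_space.

Local Notation cls := (\pi_quotient_space).

Lemma quotient_eqP u v : cls u = cls v <-> S (u - v).
Proof.
by split=> [/eqmodP/asboolP//|h]; apply/eqmodP/asboolP.
Qed.

Definition quotient_add (x y : quotient_space) : quotient_space :=
  cls (repr x + repr y).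
Definition quotient_opp (x : quotient_space) : quotient_space := cls (- repr x).
Definition quotient_scale (a : R) (x : quotient_space) : quotient_space :=
  cls (a *: repr x).

Let repr_cls u : S (repr (cls u) - u).
Proof. by apply/quotient_eqP; rewrite reprK. Qed.

Lemma cls_add u v : quotient_add (cls u) (cls v) = cls (u + v).
Proof. by apply/quotient_eqP; rewrite opprD addrACA; apply: subspaceD. Qed.

Lemma cls_opp u : quotient_opp (cls u) = cls (- u).
Proof. by apply/quotient_eqP; rewrite -opprD; apply: subspaceN. Qed.

Lemma cls_scale a u : quotient_scale a (cls u) = cls (a *: u).
Proof.
apply/quotient_eqP; rewrite -scalerBr -[_ *: _]addr0.
by apply: subspaceP => //; exact: subspace0.
Qed.

Let quotient_ind (P : quotient_space -> Prop) : (forall u, P (cls u)) ->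
  forall x, P x.
Proof. by move=> H x; rewrite -[x]reprK. Qed.

Let addA : associative quotient_add.
Proof.
elim/quotient_ind => u; elim/quotient_ind => v; elim/quotient_ind => w.
by rewrite !cls_add addrA.
Qed.
Let addC : commutative quotient_add.
Proof.
by elim/quotient_ind => u; elim/quotient_ind => v; rewrite !cls_add addrC.
Qed.
Let add0 : left_id (cls 0) quotient_add.
Proof. by elim/quotient_ind => u; rewrite cls_add add0r. Qed.
Let addN : left_inverse (cls 0) quotient_opp quotient_add.
Proof. by elim/quotient_ind => u; rewrite cls_opp cls_add addNr. Qed.

HB.instance Definition _ := GRing.isZmodule.Build quotient_space addA addC add0 addN.

Let scaleA a b x : quotient_scale a (quotient_scale b x) =
  quotient_scale (a * b) x.
Proof. by elim/quotient_ind: x => u; rewrite !cls_scale scalerA. Qed.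
Let scale1 : left_id 1 quotient_scale.
Proof. by elim/quotient_ind => u; rewrite cls_scale scale1r. Qed.
Let scaleDr : right_distributive quotient_scale +%R.
Proof.
move=> a; elim/quotient_ind => u; elim/quotient_ind => v.
by rewrite [cls u + _]cls_add !cls_scale [RHS]cls_add scalerDr.
Qed.
Let scaleDl x : {morph quotient_scale^~ x : a b / a + b}.
Proof.
move=> a b; elim/quotient_ind: x => u.
by rewrite !cls_scale [RHS]cls_add scalerDl.
Qed.

HB.instance Definition _ := GRing.Zmodule_isLmodule.Build R quotient_space
  scaleA scale1 scaleDr scaleDl.

End QuotientSpace.

Section DependentProduct.
Variables (I : Type) (V : I -> lmodType R).

Definition dprod : Type := forall i, V i.
HB.instance Definition _ := gen_eqMixin dprod.
HB.instance Definition _ := gen_choiceMixin dprod.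

Implicit Types f g h : dprod.

Let dext f g : (forall i, f i = g i) -> f = g.
Proof. exact: functional_extensionality_dep. Qed.

Definition dprod_add f g : dprod := fun i => f i + g i.
Definition dprod_opp f : dprod := fun i => - f i.
Definition dprod_scale (a : R) f : dprod := fun i => a *: f i.

Let addA : associative dprod_add.
Proof. by move=> f g h; apply: dext => i; exact: addrA. Qed.
Let addC : commutative dprod_add.
Proof. by move=> f g; apply: dext => i; exact: addrC. Qed.
Let add0 : left_id (fun i => 0) dprod_add.
Proof. by move=> f; apply: dext => i; exact: add0r. Qed.
Let addN : left_inverse (fun i => 0) dprod_opp dprod_add.
Proof. by move=> f; apply: dext => i; exact: addNr. Qed.

HB.instance Definition _ := GRing.isZmodule.Build dprod addA addC add0 addN.

Let scaleA a b f : dprod_scale a (dprod_scale b f) = dprod_scale (a * b) f.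
Proof. by apply: dext => i; exact: scalerA. Qed.
Let scale1 : left_id 1 dprod_scale.
Proof. by move=> f; apply: dext => i; exact: scale1r. Qed.
Let scaleDr : right_distributive dprod_scale +%R.
Proof. by move=> a f g; apply: dext => i; exact: scalerDr. Qed.
Let scaleDl f : {morph dprod_scale^~ f : a b / a + b}.
Proof. by move=> a b; apply: dext => i; exact: scalerDl. Qed.

HB.instance Definition _ := GRing.Zmodule_isLmodule.Build R dprod
  scaleA scale1 scaleDr scaleDl.

End DependentProduct.

(* The cochains of degree r form the subspace [cochain r] of the ambient
   space [ambient r]; the differential is given on the whole ambient space, but
   is only meaningful, and linear, on cochains. *)
Record cochain_complex := CochainComplex {
  ambient : nat -> lmodType R;
  cochain : forall r, subspace (ambient r);
  differential : forall r, ambient r -> ambient r.+1;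
  differentialP : forall r (a : R) (u v : ambient r),
    cochain r u -> cochain r v ->
    differential (a *: u + v) = a *: differential u + differential v }.

Section Cohomology.
Variable C : cochain_complex.

Lemma differential0 r : differential (0 : ambient C r) = 0.
Proof.
have c0 := subspace0 (cochain C r).
have := differentialP (-1) c0 c0.
by rewrite addr0 scaler0 scaleN1r addNr.
Qed.

Definition cocycle_set r : set (ambient C r) :=
  [set u | cochain C r u /\ differential u = 0].

Lemma cocycle0 r : cocycle_set (0 : ambient C r).
Proof. by split; [exact: subspace0|exact: differential0]. Qed.

Lemma cocycleP r (a : R) (u v : ambient C r) :
  cocycle_set u -> cocycle_set v -> cocycle_set (a *: u + v).
Proof.
move=> [cu du] [cv dv]; split; first exact: subspaceP.
by rewrite differentialP // du dv scaler0 addr0.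
Qed.

Definition cocycles r := Subspace (@cocycle0 r) (@cocycleP r).

(* cohomology is Z / (Z `&` B), which is Z / B since B `<=` Z in a complex *)
Definition coboundary_set r : set (subspace_type (cocycles r)) :=
  match r with
  | 0 => [set z | z = 0]
  | s.+1 => [set z | exists2 u, cochain C s u & subspace_val z = differential u]
  end.

Lemma coboundary0 r : coboundary_set (0 : subspace_type (cocycles r)).
Proof.
case: r => [//|r]; exists 0; first exact: subspace0.
by rewrite differential0; exact: (raddf0 val).
Qed.

Lemma coboundaryP r (a : R) (y z : subspace_type (cocycles r)) :
  coboundary_set y -> coboundary_set z -> coboundary_set (a *: y + z).
Proof.
case: r y z => [|r] y z; first by move=> -> ->; rewrite scaler0 addr0.
move=> [u cu yu] [v cv zv]; exists (a *: u + v); first exact: subspaceP.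
rewrite differentialP // -yu -zv.
exact: (linearP val).
Qed.

Definition coboundaries r := Subspace (@coboundary0 r) (@coboundaryP r).

Definition cohomology (r : nat) := quotient_space (coboundaries r).

End Cohomology.

End LinearAlgebra.

Section Forms.
Context {R : realType}.

(* The value at x of an r-form w is w x, where the r argument vectors are the
   rows of an r x n matrix. *)
Definition form (n r : nat) := 'rV[R]_n -> 'M[R]_(r, n) -> R.
HB.instance Definition _ n r := GRing.Lmodule.on (form n r).

Definition multilinear n r (w : 'M[R]_(r, n) -> R) : Prop :=
  forall (i : 'I_r) (a : R) (t u v : 'M[R]_(r, n)),
    row i t = a *: row i u + row i v ->
    row' i t = row' i u -> row' i t = row' i v ->
    w t = a * w u + w v.

Definition alternating n r (w : 'M[R]_(r, n) -> R) : Prop :=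
  forall (i j : 'I_r) v, i != j -> row i v = row j v -> w v = 0.

(* w is an element of Omega^r(U). The values outside U are set to 0, so that
   equality of elements of Omega^r(U) is equality of functions. *)
Definition is_form n r (U : set 'rV[R]_n) (w : form n r) : Prop :=
  [/\ forall x, U x -> multilinear (w x),
      forall x, U x -> alternating (w x),
      forall v, smooth U (fun x => w x v) &
      forall x v, ~ U x -> w x v = 0].

(* On constant vector fields the terms of the invariant formula of the exterior
   differential which contain Lie brackets vanish. *)
Definition ext_diff n r (U : set 'rV[R]_n) (w : form n r) : form n r.+1 :=
  fun x v =>
    if `[< U x >] then
      \sum_(i < r.+1) (-1) ^+ i *
        'D_(row i v) (fun y => w y (row' i v) : R) x
    else 0.

Definition pullback n m r (h : 'rV[R]_m -> 'rV[R]_n) (w : form n r) :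
    form m r :=
  fun x v => w (h x) (v *m jacobian h x).

Definition interior n r (X : 'rV[R]_n -> 'rV[R]_n) :
    form n r -> form n r.-1 :=
  match r with
  | 0 => fun _ => 0
  | s.+1 => fun w x u => w x (col_mx (X x) u)
  end.

Lemma form_linE n r (a : R) (w w' : form n r) x v :
  (a *: w + w') x v = a * w x v + w' x v.
Proof. by []. Qed.

Lemma is_form0 n r (U : set 'rV[R]_n) : is_form U (0 : form n r).
Proof.
split=> [x _ i a t u v _ _ _|x _ i j v _ _|v k|//].
- by rewrite mulr0 addr0.
- by [].
- exact: (Ck_cst k U (0 : R)).
Qed.

Lemma is_form_lin n r (U : set 'rV[R]_n) (a : R) (w w' : form n r) :
  open U -> is_form U w -> is_form U w' -> is_form U (a *: w + w').
Proof.
move=> oU [m1 a1 s1 z1] [m2 a2 s2 z2]; split.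
- move=> x Ux i b t u v e1 e2 e3; rewrite !form_linE.
  rewrite (m1 x Ux i b t u v) // (m2 x Ux i b t u v) //.
  by rewrite !mulrDr addrACA (mulrCA a b).
- move=> x Ux i j v ij e; rewrite form_linE.
  by rewrite (a1 x Ux i j) // (a2 x Ux i j) // mulr0 addr0.
- by move=> v k; apply: (Ck_lin a oU (s1 v k) (s2 v k)).
- by move=> x v Ux; rewrite form_linE z1 // z2 // mulr0 addr0.
Qed.

Lemma ext_diff_lin n r (U : set 'rV[R]_n) (a : R) (w w' : form n r) :
  is_form U w -> is_form U w' ->
  ext_diff U (a *: w + w') = a *: ext_diff U w + ext_diff U w'.
Proof.
move=> [_ _ s1 _] [_ _ s2 _]; apply/funext => x; apply/funext => v.
rewrite form_linE /ext_diff; case: asboolP => [Ux|_]; last first.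
  by rewrite mulr0 addr0.
rewrite mulr_sumr -big_split /=; apply: eq_bigr => i _.
have d1 : derivable (fun y => w y (row' i v) : R) x (row i v).
  by apply: diff_derivable; have [+ _] := s1 (row' i v) 1; apply.
have d2 : derivable (fun y => w' y (row' i v) : R) x (row i v).
  by apply: diff_derivable; have [+ _] := s2 (row' i v) 1; apply.
rewrite mulrCA -mulrDr; congr (_ * _).
rewrite -[a * _]/(a *: _) -(deriveZ a d1).
by rewrite -(deriveD (@derivableZ _ _ _ _ a _ _ d1) d2).
Qed.

Lemma interior_lin n r (X : 'rV[R]_n -> 'rV[R]_n) (a : R) (w w' : form n r) :
  interior X (a *: w + w') = a *: interior X w + interior X w'.
Proof. by case: r w w' => // w w'; rewrite /= scaler0 addr0. Qed.

Section Families.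
Variables (I : Type) (dim : I -> nat) (dom : forall i, set 'rV[R]_(dim i)).
Arguments dom : clear implicits.

Definition form_family (r : nat) : lmodType R :=
  @dprod R I (fun i => form (dim i) r : lmodType R).

Definition is_form_family r (w : form_family r) : Prop :=
  forall i, is_form (dom i) (w i).

Definition family_diff r (w : form_family r) : form_family r.+1 :=
  fun i => ext_diff (dom i) (w i).

Lemma family_linE r (a : R) (w w' : form_family r) i :
  (a *: w + w') i = a *: w i + w' i.
Proof. by []. Qed.

Lemma family_diff_lin r (a : R) (w w' : form_family r) :
  is_form_family w -> is_form_family w' ->
  family_diff (a *: w + w') = a *: family_diff w + family_diff w'.
Proof.
move=> fw fw'; apply: functional_extensionality_dep => i.
exact: (ext_diff_lin a (fw i) (fw' i)).
Qed.

End Families.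

End Forms.

Section Diffeology.
Context {R : realType}.

(* Only the values on plot_dom matter: two plots with the same domain which
   agree on it represent the same plot. *)
Record plot (X : Type) := Plot {
  plot_dim : nat;
  plot_dom : set 'rV[R]_plot_dim;
  plot_open : open plot_dom;
  plot_map :> 'rV[R]_plot_dim -> X }.
Arguments plot_dom {X} p _ : rename.

(* b = a o h for some given h from the domain of b to the domain of a *)
Definition plot_factor X (a b : plot X)
    (h : 'rV[R]_(plot_dim b) -> 'rV[R]_(plot_dim a)) : Prop :=
  [/\ smooth (plot_dom b) h,
      forall t, plot_dom b t -> plot_dom a (h t) &
      forall t, plot_dom b t -> b t = a (h t)].

Record diffeology (X : Type) := Diffeology {
  plots :> plot X -> Prop;
  plots_cst : forall a : plot X,
    (forall s t, plot_dom a s -> plot_dom a t -> a s = a t) -> plots a;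
  plots_comp : forall (a b : plot X) h,
    plots a -> plot_factor (a := a) (b := b) h -> plots b;
  plots_local : forall a : plot X,
    (forall t, plot_dom a t ->
       exists (V : set 'rV[R]_(plot_dim a)) (oV : open V),
         [/\ V t, V `<=` plot_dom a & plots (Plot oV a)]) ->
    plots a }.

Section DeRham.
Variables (X : Type) (D : diffeology X).

Definition plot_of : Type := {a : plot X | D a}.

Definition pdom (a : plot_of) : set 'rV[R]_(plot_dim (sval a)) := plot_dom (sval a).
Arguments pdom : clear implicits.

Definition dform_set r : set (form_family (fun a : plot_of => plot_dim (sval a)) r) :=
  [set w | is_form_family pdom w /\
    forall (a b : plot_of) h, plot_factor (a := sval a) (b := sval b) h ->
      forall t v, pdom b t -> w b t v = pullback h (w a) t v].

Lemma dform0 r : dform_set (0 : form_family _ r).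
Proof. by split=> // i; exact: is_form0. Qed.

Lemma dformP r (c : R) (u v : form_family _ r) :
  dform_set u -> dform_set v -> dform_set (c *: u + v).
Proof.
move=> [fu cu] [fv cv]; split=> [i|a b h abh t w dt].
  rewrite family_linE; apply: is_form_lin; [exact: plot_open|exact: fu|exact: fv].
by rewrite family_linE form_linE (cu a b h) // (cv a b h).
Qed.

Definition dforms r := Subspace (@dform0 r) (@dformP r).

Lemma dform_diffP r (c : R) (u v : form_family _ r) :
  dforms r u -> dforms r v ->
  family_diff pdom (c *: u + v) = c *: family_diff pdom u + family_diff pdom v.
Proof. by move=> [fu _] [fv _]; exact: family_diff_lin. Qed.

Definition deRham_complex := CochainComplex dform_diffP.

End DeRham.

End Diffeology.

Arguments plot_dom {R X} p _ : rename.

Section Manifolds.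
Context {R : realType}.

(* chart_inv is the inverse homeomorphism from chart_img to chart_dom *)
Record chart (M : topologicalType) (n : nat) := Chart {
  chart_dom : set M;
  chart_map :> M -> 'rV[R]_n;
  chart_inv : 'rV[R]_n -> M;
  chart_dom_open : open chart_dom;
  chart_img_open : open (chart_map @` chart_dom);
  chart_mapK : forall x, chart_dom x -> chart_inv (chart_map x) = x;
  chart_map_continuous : {within chart_dom, continuous chart_map};
  chart_inv_continuous : {within chart_map @` chart_dom, continuous chart_inv} }.

Definition chart_img M n (c : chart M n) : set 'rV[R]_n := c @` chart_dom c.

Definition overlap M n (c c' : chart M n) : set 'rV[R]_n :=
  c @` (chart_dom c `&` chart_dom c').

Definition transition M n (c c' : chart M n) : 'rV[R]_n -> 'rV[R]_n :=
  c' \o chart_inv c.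

Definition compatible M n (c c' : chart M n) : Prop :=
  smooth (overlap c c') (transition c c') /\
  smooth (overlap c' c) (transition c' c).

Record manifold (n : nat) := Manifold {
  carrier :> topologicalType;
  atlas : set (chart carrier n);
  carrier_hausdorff : hausdorff_space carrier;
  carrier_second_countable : @second_countable carrier;
  atlas_cover : forall x, exists2 c, atlas c & chart_dom c x;
  atlas_compatible : forall c c', atlas c -> atlas c' -> compatible c c' }.
Arguments atlas {n} M _ : rename.

(* the maximal atlas *)
Definition charts n (M : manifold n) : set (chart M n) :=
  [set c | forall c', atlas M c' -> compatible c c'].
Arguments charts {n} M _ : rename.

(* Smooth maps from an open subset U of R^m to M *)
Definition smooth_to n (M : manifold n) m (U : set 'rV[R]_m)
    (f : 'rV[R]_m -> M) : Prop :=
  forall x, U x -> exists (c : chart M n) (V : set 'rV[R]_m),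
    [/\ charts M c, open_nbhs x V, V `<=` f @^-1` chart_dom c &
        smooth V (c \o f)].

(* Smooth maps from an arbitrary subset A of R^m to M: locally, they extend to
   smooth maps on open subsets of R^m. *)
Definition smooth_ext n (M : manifold n) m (A : set 'rV[R]_m)
    (f : 'rV[R]_m -> M) : Prop :=
  forall x, A x -> exists (V : set 'rV[R]_m) (g : 'rV[R]_m -> M),
    [/\ open_nbhs x V, smooth_to V g & forall z, V z -> A z -> f z = g z].

Definition smooth_map m (X : manifold m) n (M : manifold n) (f : X -> M) : Prop :=
  forall c, charts X c -> smooth_to (chart_img c) (f \o chart_inv c).

Definition smooth_path n (M : manifold n) (mu : R -> M) : Prop :=
  smooth_ext [set t : 'rV[R]_1 | 0 <= t 0 0 <= 1] (fun t => mu (t 0 0)).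

(* Smoothness on U x [0,1] for U open in X, read in the charts of X x R *)
Definition smooth_homotopy m (X : manifold m) n (M : manifold n) (U : set X)
    (H : X -> R -> M) : Prop :=
  forall c, charts X c ->
    smooth_ext
      [set z : 'rV[R]_(m + 1) | (c @` (chart_dom c `&` U)) (lsubmx z) /\
                                0 <= rsubmx z 0 0 <= 1]
      (fun z => H (chart_inv c (lsubmx z)) (rsubmx z 0 0)).

(* Differential forms and vector fields on M are given by their expressions in
   the charts of the maximal atlas. *)
Section FormsOnManifold.
Variables (n : nat) (M : manifold n).

Definition chart_of : Type := {c : chart M n | charts M c}.

Definition cimg (c : chart_of) : set 'rV[R]_n := chart_img (sval c).

Definition mform_family (r : nat) : lmodType R :=
  form_family (fun _ : chart_of => n) r.

Definition mform_diff r (w : mform_family r) : mform_family r.+1 :=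
  family_diff cimg w.

Definition is_mform r (w : mform_family r) : Prop :=
  is_form_family cimg w /\
  forall (c c' : chart_of) x v, overlap (sval c) (sval c') x ->
    w c x v = pullback (transition (sval c) (sval c')) (w c') x v.

Definition is_vector_field (X : chart_of -> 'rV[R]_n -> 'rV[R]_n) : Prop :=
  (forall c, smooth (cimg c) (X c)) /\
  forall (c c' : chart_of) x, overlap (sval c) (sval c') x ->
    X c' (transition (sval c) (sval c') x) =
    X c x *m jacobian (transition (sval c) (sval c')) x.

End FormsOnManifold.

(* A foliation of dimension p and codimension q, given by a foliated atlas: the
   image of each chart is a product, with connected first factor, in
   R^p x R^q, and the changes of charts have locally the form
   (x, y) |-> (h1(x, y), h2(y)). *)
Record foliation (p q : nat) (M : manifold (p + q)) := Foliation {
  fatlas : set (chart M (p + q));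
  fatlas_charts : fatlas `<=` charts M;
  fatlas_cover : forall x, exists2 c, fatlas c & chart_dom c x;
  fatlas_product : forall c, fatlas c ->
    exists (P : set 'rV[R]_p) (T : set 'rV[R]_q),
      [/\ open P, connected P, open T &
          chart_img c = [set z | P (lsubmx z) /\ T (rsubmx z)]];
  fatlas_transition : forall c c', fatlas c -> fatlas c' ->
    forall z, overlap c c' z -> exists V : set 'rV[R]_(p + q),
      [/\ open_nbhs z V, V `<=` overlap c c' &
          forall z1 z2, V z1 -> V z2 -> rsubmx z1 = rsubmx z2 ->
            rsubmx (transition c c' z1) = rsubmx (transition c c' z2)] }.
Arguments fatlas {p q M} F _ : rename.

Section Foliations.
Variables (p q : nat) (M : manifold (p + q)) (F : foliation M).

Definition same_plaque (x y : M) : Prop :=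
  exists2 c, fatlas F c &
    [/\ chart_dom c x, chart_dom c y & rsubmx (c x) = rsubmx (c y)].

(* two points lie on the same leaf iff they are joined by a chain of plaques *)
Definition same_leaf : M -> M -> Prop := clos_refl_sym_trans M same_plaque.

Definition leaf_rel (x y : M) : bool := `[< same_leaf x y >].

Lemma leaf_rel_equiv : equiv_class_of leaf_rel.
Proof.
split=> [x|x y|y x z].
- by apply/asboolP; exact: rst_refl.
- by apply/asboolP/asboolP => h; exact: rst_sym.
- by move=> /asboolP xy /asboolP yz; apply/asboolP; exact: rst_trans yz.
Qed.

Canonical leaf_equiv := EquivRelPack leaf_rel_equiv.

Definition leaf_space := {eq_quot leaf_equiv}.
HB.instance Definition _ := Choice.on leaf_space.
HB.instance Definition _ := EqQuotient.on leaf_space.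

Definition leaf_proj (x : M) : leaf_space := \pi_leaf_space x.

(* The component of the velocity transverse to the leaves is 0; at the end points
   of [0,1] the limit is one-sided. *)
Definition tangential_path (mu : R -> M) : Prop :=
  smooth_path mu /\
  forall c t, fatlas F c -> 0 <= t <= 1 -> chart_dom c (mu t) ->
    (fun s => (s - t)^-1 *: rsubmx (c (mu s) - c (mu t)))
      @ within [set s | 0 <= s <= 1] t^' --> (0 : 'rV[R]_q).

Definition Q_foliation : Prop :=
  forall m (X : manifold m) (x : X) (beta gamma : X -> M) (mu : R -> M),
    smooth_map beta -> smooth_map gamma ->
    (forall y, leaf_proj (beta y) = leaf_proj (gamma y)) ->
    tangential_path mu -> mu 0 = beta x -> mu 1 = gamma x ->
    exists (U : set X) (H : X -> R -> M),
      [/\ open_nbhs x U, smooth_homotopy U H,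
          forall y, U y -> H y 0 = beta y /\ H y 1 = gamma y,
          forall t, 0 <= t <= 1 -> H x t = mu t &
          forall y, U y -> tangential_path (H y)].

Definition quotient_plot (a : plot leaf_space) : Prop :=
  forall t, plot_dom a t ->
    exists (V : set 'rV[R]_(plot_dim a)) (beta : 'rV[R]_(plot_dim a) -> M),
      [/\ open_nbhs t V, V `<=` plot_dom a, smooth_to V beta &
          forall s, V s -> a s = leaf_proj (beta s)].

Definition tangent_vector_field (X : chart_of M -> 'rV[R]_(p + q) -> 'rV[R]_(p + q)) :
    Prop :=
  is_vector_field X /\
  forall (c : chart_of M) x, fatlas F (sval c) -> cimg c x -> rsubmx (X c x) = 0.

Definition basic_set r : set (mform_family M r) :=
  [set w | is_mform w /\
    forall X, tangent_vector_field X ->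
      forall (c : chart_of M) x, cimg c x ->
        (forall v, interior (X c) (w c) x v = 0) /\
        (forall v, interior (X c) ((mform_diff w : mform_family M r.+1) c) x v = 0)].

Lemma basic0 r : basic_set (0 : mform_family M r).
Proof.
have d0 : mform_diff (0 : mform_family M r) = 0.
  apply: functional_extensionality_dep => c; apply/funext => x; apply/funext => v.
  rewrite /mform_diff /family_diff /ext_diff; case: asboolP => // _.
  rewrite big1 // => i _; rewrite -[X in _ * X]/('D_(row i v) (cst (0 : R)) x).
  by rewrite derive_cst mulr0.
split; first by split=> // c; exact: is_form0.
by move=> X _ c x _; rewrite d0; split=> v //; case: r v {d0}.
Qed.

Lemma mform_diff_lin r (a : R) (u v : mform_family M r) :
  is_mform u -> is_mform v ->
  mform_diff (a *: u + v) = a *: mform_diff u + mform_diff v.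
Proof. by move=> [fu _] [fv _]; exact: family_diff_lin. Qed.

Lemma basicP r (a : R) (u v : mform_family M r) :
  basic_set u -> basic_set v -> basic_set (a *: u + v).
Proof.
move=> [mu bu] [mv bv]; split.
  case: (mu) (mv) => [fu cu] [fv cv]; split=> [c|c c' x w o].
    rewrite family_linE.
    by apply: is_form_lin; [exact: chart_img_open|exact: fu|exact: fv].
  by rewrite family_linE form_linE (cu c c') // (cv c c').
move=> X tX c x cx; have [u1 u2] := bu X tX c x cx.
have [v1 v2] := bv X tX c x cx; split=> w.
  by rewrite family_linE interior_lin form_linE u1 v1 mulr0 addr0.
rewrite mform_diff_lin // family_linE interior_lin.
by rewrite form_linE u2 v2 mulr0 addr0.
Qed.

Definition basic_forms r := Subspace (@basic0 r) (@basicP r).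

Lemma basic_diffP r (a : R) (u v : mform_family M r) :
  basic_forms r u -> basic_forms r v ->
  mform_diff (a *: u + v) = a *: mform_diff u + mform_diff v.
Proof. by move=> [mu _] [mv _]; exact: mform_diff_lin. Qed.

Definition basic_complex := CochainComplex basic_diffP.

Lemma quotient_plot_cst (a : plot leaf_space) :
  (forall s t, plot_dom a s -> plot_dom a t -> a s = a t) -> quotient_plot a.
Proof.
move=> ca t at_; exists (plot_dom a), (fun _ => repr (a t)); split => //.
- by split=> //; exact: plot_open.
- move=> x _; have [c ac cm] := atlas_cover (repr (a t)).
  exists c, setT; split=> //.
  + by move=> c' ac'; exact: atlas_compatible.
  + by split=> //; exact: openT.
  + by move=> k; exact: Ck_cst.
- by move=> s as_; rewrite /leaf_proj reprK; exact: ca.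
Qed.

Lemma open_preimage m n (U : set 'rV[R]_m) (V : set 'rV[R]_n)
    (h : 'rV[R]_m -> 'rV[R]_n) :
  open U -> open V -> smooth U h -> open (U `&` h @^-1` V).
Proof.
move=> oU oV sh; rewrite openE => x [Ux Vx]; apply: filterI.
  exact: open_nbhs_nbhs.
by have := sh 0%N x Ux; apply; exact: open_nbhs_nbhs.
Qed.

Lemma quotient_plot_comp (a b : plot leaf_space) h :
  quotient_plot a -> plot_factor (a := a) (b := b) h -> quotient_plot b.
Proof.
move=> qa [sh hd hE] t bt.
have ob := @plot_open _ _ b.
have [V [beta [[oV Vt] Va sbeta aE]]] := qa (h t) (hd t bt).
exists (plot_dom b `&` h @^-1` V), (beta \o h); split.
- by split; [exact: open_preimage|].
- by move=> s [].
- move=> s [bs Vs]; have [c [W [cc [oW Ws] Wc sW]]] := sbeta _ Vs.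
  exists c, (plot_dom b `&` h @^-1` W); split=> //.
  + by split; [exact: open_preimage|].
  + by move=> z [_ Wz]; exact: (Wc _ Wz).
  + apply: (@smooth_comp _ _ _ _ W _ (c \o beta) h oW) => //.
    * exact: open_preimage.
    * by move=> z [].
    * by move=> k; apply: Ck_sub (sh k) => z [].
- by move=> s [bs Vs]; rewrite hE // aE.
Qed.

Lemma quotient_plot_local (a : plot leaf_space) :
  (forall t, plot_dom a t ->
     exists (V : set 'rV[R]_(plot_dim a)) (oV : open V),
       [/\ V t, V `<=` plot_dom a & quotient_plot (Plot oV a)]) ->
  quotient_plot a.
Proof.
move=> H t at_; have [V [oV [Vt Va qV]]] := H t at_.
have [W [beta [oW WV sW WE]]] := qV t Vt.
by exists W, beta; split=> // z /WV /Va.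
Qed.

Definition quotient_diffeology : diffeology leaf_space :=
  Diffeology quotient_plot_cst quotient_plot_comp quotient_plot_local.

End Foliations.

End Manifolds.

Arguments atlas {R n} M _ : rename.
Arguments charts {R n} M _ : rename.
Arguments fatlas {R p q M} F _ : rename.

(* Main.v *)
Require Import Defs.
From HB Require Import structures.
From mathcomp Require Import perm.
From mathcomp Require Import all_boot all_order all_algebra.
From mathcomp Require Import all_classical all_reals all_analysis.
From mathcomp Require Import ring.
(* Again, so that [form], [interior], [subspace] and [alternating] are those of
   Defs. *)
Import Defs.
Import Order.TTheory GRing.Theory Num.Theory numFieldNormedType.Exports.
Local Open Scope ring_scope.

(** A form w on the diffeological space M/F is determined by its values on the
    plots pi o c^-1, for the charts c of M, since every plot of M/F is locally of
    the form pi o beta. These values form a differential form on M. It is basic: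
    on a foliated chart, pi o c^-1 factors through the projection of the chart to
    its transverse factor.

    Conversely, let u be a basic form. It induces the form on M/F whose value on
    the plot alpha is beta^* u where alpha = pi o beta, provided that beta^* u and
    gamma^* u agree at x whenever pi o beta = pi o gamma near x. Tangent vectors to
    F extend to tangent vector fields, by means of bump functions, so in a foliated
    chart u kills the vectors tangent to F and, since du kills them too, is
    constant along the plaques. Hence beta^* u does not change when beta is
    translated along a plaque, and by following a chain of plaques one may assume
    that beta(x) = gamma(x). The tubular property for the constant path then gives
    tangential paths from beta(y) to gamma(y) which, for y close to x, stay in one
    foliated chart; so beta and gamma have the same transverse coordinate near x,
    and therefore beta^* u = gamma^* u at x.

    Both constructions commute with d, the second one because d commutes with
    pullbacks. *)

Set Implicit Arguments.
Unset Strict Implicit.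
Unset Printing Implicit Defensive.
Local Open Scope classical_set_scope.

(** * Cohomology isomorphisms *)

Section QuotientMap.
Context {R : realType}.
Variables (V W : lmodType R) (S : subspace V) (T : subspace W).
Local Open Scope quotient_scope.

(** The map is computed on the representative chosen by [repr]. Two representatives differ by an
    element of [S], which [g] sends into [T]. *)
Lemma quotient_map_linear (g : V -> W) :
  linear g -> (forall v, S v -> T (g v)) ->
  exists f : {linear quotient_space S -> quotient_space T},
    forall v, f (\pi_(quotient_space S) v) = \pi_(quotient_space T) (g v).
Proof.
move=> lg gST.
pose f (x : quotient_space S) : quotient_space T := \pi_(quotient_space T) (g (repr x)).
have fE v : f (\pi_(quotient_space S) v) = \pi_(quotient_space T) (g v).
  apply/quotient_eqP; have /quotient_eqP :
    \pi_(quotient_space S) (repr (\pi_(quotient_space S) v)) =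
    \pi_(quotient_space S) v by rewrite reprK.
  move=> /gST; congr (T _).
  by rewrite addrC -scaleN1r lg scaleN1r addrC.
have lf : linear f.
  have lin a u v :
      f (quotient_add (quotient_scale a (\pi_(quotient_space S) u))
                      (\pi_(quotient_space S) v)) =
      quotient_add (quotient_scale a (f (\pi_(quotient_space S) u)))
                   (f (\pi_(quotient_space S) v)).
    by rewrite cls_scale cls_add !fE lg cls_scale cls_add.
  by move=> a x y; have := lin a (repr x) (repr y); rewrite !reprK.
pose L := GRing.isLinear.Build R (quotient_space S) (quotient_space T) *:%R f lf.
pose F : {linear quotient_space S -> quotient_space T} := HB.pack f L.
by exists F => v; exact: fE.
Qed.

End QuotientMap.

Section CohomologyIso.
Context {R : realType}.
Variables (C D : cochain_complex (R := R)) (r : nat).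
Variable phi : {linear ambient C r -> ambient D r}.

(** The direct implication of the second hypothesis makes the induced map well defined and its
    converse makes it injective; lifting cocycles gives surjectivity. *)
Lemma cohomology_iso :
  (forall z, cocycles C r z -> cocycles D r (phi z)) ->
  (forall (z : subspace_type (cocycles C r)) (y : subspace_type (cocycles D r)),
     subspace_val y = phi (subspace_val z) ->
     coboundaries C r z <-> coboundaries D r y) ->
  (forall y, cocycles D r y -> exists2 z, cocycles C r z & phi z = y) ->
  exists f : {linear cohomology C r -> cohomology D r}, bijective f.
Proof.
move=> phiZ phiB phiS.
have inZ (z : subspace_type (cocycles C r)) :
    phi (subspace_val z) \in (subspace_set (cocycles D r) : set _).
  rewrite inE; apply: phiZ.
  by have := subspace_valP z; rewrite inE.
pose g z : subspace_type (cocycles D r) := SubspaceElt (inZ z).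
have lg : linear g.
  move=> a u v; apply: val_inj; rewrite [RHS]linearP /=.
  rewrite -[LHS]/(phi (val (a *: u + v))).
  by rewrite [val _]linearP linearP.
have gB z : coboundaries C r z -> coboundaries D r (g z).
  by move/(phiB z (g z) erefl).
have [f fE] := quotient_map_linear lg gB.
exists f; rewrite -setTT_bijective; split=> //.
- move=> x y _ _; rewrite -[x]reprK -[y]reprK !fE => /quotient_eqP gxy.
  apply/quotient_eqP/(phiB _ (g (repr x) - g (repr y))) => //.
  rewrite -[LHS]/(val (g (repr x) - g (repr y))) raddfB.
  by rewrite -[subspace_val (_ - _)]/(val (repr x - repr y)) !raddfB.
- move=> y _; have := subspace_valP (repr y); rewrite inE => /phiS[z Zz zy].
  have zZ : z \in (subspace_set (cocycles C r) : set _) by rewrite inE.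
  exists (\pi_(quotient_space (coboundaries C r))%qT (SubspaceElt zZ)) => //.
  rewrite fE -[RHS]reprK; congr (\pi_(quotient_space (coboundaries D r))%qT _).
  exact: val_inj.
Qed.

End CohomologyIso.

(** * Symmetry of second derivatives *)

Section Calculus.
Context {R : realType}.

Lemma smooth_differentiable n (W : normedModType R) (U : set 'rV[R]_n)
  (f : 'rV[R]_n -> W) x : smooth U f -> U x -> differentiable f x.
Proof. by move=> /(_ 1)[+ _] Ux; apply. Qed.

Lemma smooth_derivable n (W : normedModType R) (U : set 'rV[R]_n)
  (f : 'rV[R]_n -> W) x v : smooth U f -> U x -> derivable f x v.
Proof. by move=> sf Ux; exact/diff_derivable/(smooth_differentiable sf). Qed.

Lemma smooth_continuous n (W : normedModType R) (U : set 'rV[R]_n)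
  (f : 'rV[R]_n -> W) x : smooth U f -> U x -> {for x, continuous f}.
Proof. by move=> /(_ 0%N) + Ux; apply. Qed.

Lemma smooth_derive n (W : normedModType R) (U : set 'rV[R]_n)
  (f : 'rV[R]_n -> W) v : smooth U f -> smooth U ('D_v f).
Proof. by move=> sf k; have [_] := sf k.+1; apply. Qed.

Lemma is_derive_line (V W : normedModType R) (f : V -> W) (x u : V) (a : R) :
  derivable f (x + a *: u) u ->
  is_derive a 1 (fun t => f (x + t *: u)) ('D_u f (x + a *: u)).
Proof.
have E : (fun h : R => h^-1 *: (((fun t => f (x + t *: u)) \o shift a) (h *: 1)
      - f (x + a *: u))) =
    (fun h => h^-1 *: ((f \o shift (x + a *: u)) (h *: u) - f (x + a *: u))).
  apply/funext => h /=.
  by rewrite [h%:A]mulr1 scalerDl addrCA.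
by move=> df; split; rewrite /derivable /derive E.
Qed.

Lemma is_derive_translate (V W : normedModType R) (f : V -> W) (x u a : V) :
  derivable f (x + a) u -> is_derive x u (fun y => f (y + a)) ('D_u f (x + a)).
Proof.
have E : (fun h : R => h^-1 *: (((fun y => f (y + a)) \o shift x) (h *: u)
      - f (x + a))) =
    (fun h => h^-1 *: ((f \o shift (x + a)) (h *: u) - f (x + a))).
  by apply/funext => h /=; rewrite addrA.
by move=> df; split; rewrite /derivable /derive E.
Qed.

Lemma mean_value_line (V : normedModType R) (f : V -> R) (x u : V) (s : R) :
  0 < s -> (forall c, 0 <= c <= s -> derivable f (x + c *: u) u) ->
  exists2 c, 0 <= c <= s & f (x + s *: u) - f x = 'D_u f (x + c *: u) * s.
Proof.
move=> s0 df.
have dg c : 0 <= c <= s -> is_derive c 1 (fun t => f (x + t *: u)) ('D_u f (x + c *: u)).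
  by move/df; exact: is_derive_line.
have [c| |c] := @MVT R (fun t => f (x + t *: u)) (fun c => 'D_u f (x + c *: u)) 0 s s0.
- by rewrite in_itv /= => /andP[/ltW c0 /ltW cs]; apply: dg; rewrite c0.
- apply: continuous_in_subspaceT => c; rewrite inE /= in_itv /= => /dg[d _].
  by apply: differentiable_continuous; exact/derivable1_diffP.
- rewrite in_itv /= => /andP[/ltW c0 /ltW cs]; rewrite subr0 scale0r addr0 => E.
  by exists c => //; rewrite c0.
Qed.

(** Two applications of the mean value theorem: along [u] to the increment of [f] in the direction
    [v], then along [v] to ['D_u f]. *)
Lemma second_difference n (U : set 'rV[R]_n) (f : 'rV[R]_n -> R)
  (x u v : 'rV[R]_n) (s : R) :
  smooth U f -> 0 < s ->
  (forall c d, 0 <= c <= s -> 0 <= d <= s -> U (x + c *: u + d *: v)) ->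
  exists c d, [/\ 0 <= c <= s, 0 <= d <= s &
    (f (x + s *: u + s *: v) - f (x + s *: u)) - (f (x + s *: v) - f x) =
    'D_v ('D_u f) (x + c *: u + d *: v) * s * s].
Proof.
move=> sf s0 Us.
have ss : 0 <= s <= s by rewrite lexx ltW.
have s00 : 0 <= (0 : R) <= s by rewrite lexx ltW.
pose g y : R := f (y + s *: v) - f y.
have dg c : 0 <= c <= s -> is_derive (x + c *: u) u g
    ('D_u f (x + c *: u + s *: v) - 'D_u f (x + c *: u)).
  move=> cs.
  have d1 : is_derive (x + c *: u) u (fun y => f (y + s *: v))
      ('D_u f (x + c *: u + s *: v)).
    apply: is_derive_translate; apply: (smooth_derivable (v := u) sf); exact: Us.
  have d2 : is_derive (x + c *: u) u f ('D_u f (x + c *: u)).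
    apply: derivableP; apply: smooth_derivable sf _.
    by have := Us c 0 cs s00; rewrite scale0r addr0.
  exact: is_deriveB.
have [c cs gE] := mean_value_line s0 (fun c cs => @ex_derive _ _ _ _ _ _ _ (dg c cs)).
have [d ds dE] := @mean_value_line _ ('D_u f) (x + c *: u) v s s0
  (fun d ds => smooth_derivable (v := v) (smooth_derive u sf) (Us c d cs ds)).
exists c, d; split=> //.
have [_ E] := dg c cs.
by rewrite -/(g x) -/(g (x + s *: u)) gE E dE.
Qed.

(** The points [y] and [z] may differ: two uses of the mean value theorem yield unrelated
    intermediate points. *)
Lemma continuous_eq_near (V : normedModType R) (f g : V -> R) (x : V) :
  {for x, continuous f} -> {for x, continuous g} ->
  (forall r : R, 0 < r -> exists y z, [/\ ball x r y, ball x r z & f y = g z]) ->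
  f x = g x.
Proof.
move=> cf cg fg; apply/eqP; rewrite -subr_eq0 -normr_le0.
apply/ler_addgt0Pr => e e0; rewrite add0r.
have e2 : 0 < e / 2 by rewrite divr_gt0.
have /cvgrPdist_lt/(_ _ e2) h1 := cf; have /cvgrPdist_lt/(_ _ e2) h2 := cg.
have : nbhs x [set t | `|f x - f t| < e / 2 /\ `|g x - g t| < e / 2].
  exact: filterI h1 h2.
move=> /nbhs_ballP[r /= r0 xr].
have [y [z [/xr[/= fy _] /xr[/= _ gz] E]]] := fg r r0.
rewrite -(subrKA (f y)) (le_trans (ler_normD _ _))// [leRHS]splitr lerD //.
  exact: ltW.
by rewrite E distrC ltW.
Qed.

(* The second difference at x along u and v is symmetric in u and v, and by the
   mean value theorem it is s^2 times a value, near x, of either mixed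
   derivative. *)
Lemma smooth_derive_comm n (U : set 'rV[R]_n) (f : 'rV[R]_n -> R)
  (x u v : 'rV[R]_n) :
  open U -> smooth U f -> U x -> 'D_u ('D_v f) x = 'D_v ('D_u f) x.
Proof.
move=> oU sf Ux.
apply: (continuous_eq_near (smooth_continuous (smooth_derive u (smooth_derive v sf)) Ux)
  (smooth_continuous (smooth_derive v (smooth_derive u sf)) Ux)) => r r0.
have : nbhs x (U `&` ball x r).
  by apply: filterI; [exact: open_nbhs_nbhs|exact: nbhsx_ballx].
move=> /nbhs_ballP[r1 /= r10 xr].
(* With this side, the parallelogram at [x] along [u] and [v] stays within [r1 / 2] of [x]; the
   summand 1 keeps the denominator positive when [u = v = 0]. *)
pose s := r1 / 2 / (`|u| + `|v| + 1).
have N0 : 0 < `|u| + `|v| + 1 by rewrite ltr_wpDl // addr_ge0.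
have s0 : 0 < s by rewrite !divr_gt0.
(* Stated for a general pair, so as to serve for both orders of [u] and [v]. *)
have inb c d a b : `|a| + `|b| <= `|u| + `|v| -> 0 <= c <= s -> 0 <= d <= s ->
    U (x + c *: a + d *: b) /\ ball x r (x + c *: a + d *: b).
  move=> ab /andP[c0 cs] /andP[d0 ds]; apply: xr.
  rewrite -ball_normE /ball_/= -addrA opprD addrA subrr add0r normrN.
  apply: (@le_lt_trans _ _ (s * (`|u| + `|v| + 1))).
    apply: (le_trans (ler_normD _ _)); rewrite !normrZ !ger0_norm//.
    apply: (@le_trans _ _ (s * (`|a| + `|b|))).
      by rewrite mulrDr lerD // ler_wpM2r.
    by rewrite ler_wpM2l ?(ltW s0)// (le_trans ab) // lerDl.
  by rewrite /s divfK ?gt_eqF// ltr_pdivrMr// ltr_pMr// ltr1n.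
have [c [d [cs ds E1]]] := second_difference sf s0
  (fun c d cs ds => (inb c d u v (lexx _) cs ds).1).
have ab : `|v| + `|u| <= `|u| + `|v| by rewrite addrC.
have [c' [d' [cs' ds' E2]]] := second_difference sf s0
  (fun c d cs ds => (inb c d v u ab cs ds).1).
exists (x + c' *: v + d' *: u), (x + c *: u + d *: v); split.
- exact: (inb _ _ _ _ ab cs' ds').2.
- exact: (inb _ _ _ _ (lexx _) cs ds).2.
- have s1 : s != 0 by rewrite gt_eqF.
  apply: (mulIf s1 (mulIf s1 (etrans (esym E2) (etrans _ E1)))).
  by rewrite [x + s *: v + _]addrAC !opprB addrACA [RHS]addrACA; congr (_ + _); exact: addrC.
Qed.

End Calculus.

Arguments smooth_derivable {R n W U f x} v _ _.

(** * Alternating multilinear maps *)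

Section Multilinear.
Context {R : realType}.
Implicit Types (n r : nat).

Lemma row'_eq r n (i : 'I_r) (A B : 'M[R]_(r, n)) :
  (forall k, k != i -> row k A = row k B) -> row' i A = row' i B.
Proof.
move=> H; apply/row_matrixP => j; apply/rowP => l; rewrite !mxE.
have /H/rowP/(_ l) : lift i j != i by rewrite eq_sym neq_lift.
by rewrite !mxE.
Qed.

Lemma eq_row' r n (i k : 'I_r) (A B : 'M[R]_(r, n)) :
  row' i A = row' i B -> k != i -> row k A = row k B.
Proof.
move=> /row_matrixP H; rewrite eq_sym => /unlift_some[j -> _].
by apply/rowP => l; have /rowP/(_ l) := H j; rewrite !mxE.
Qed.

Lemma multilinearD r n (w : 'M[R]_(r, n) -> R) (i : 'I_r) (a : R) t u v :
  multilinear w -> row i t = a *: row i u + row i v ->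
  (forall k, k != i -> row k t = row k u) ->
  (forall k, k != i -> row k t = row k v) ->
  w t = a * w u + w v.
Proof. by move=> mw ti tu tv; apply: (mw i) => //; exact: row'_eq. Qed.

Lemma multilinear0 r n (w : 'M[R]_(r, n) -> R) (i : 'I_r) t :
  multilinear w -> row i t = 0 -> w t = 0.
Proof.
move=> mw ti; have := @multilinearD _ _ w i 1 t t t mw.
rewrite ti scaler0 addr0 => /(_ erefl (fun _ _ => erefl) (fun _ _ => erefl)).
by rewrite mul1r => E; apply: (addrI (w t)); rewrite addr0 [RHS]E.
Qed.

Definition setrow r n (A : 'M[R]_(r, n)) (i : 'I_r) (b : 'rV[R]_n) : 'M[R]_(r, n) :=
  \matrix_(k, l) if k == i then b 0 l else A k l.

Lemma row_setrow r n (A : 'M[R]_(r, n)) i b : row i (setrow A i b) = b.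
Proof. by apply/rowP => l; rewrite !mxE eqxx. Qed.

Lemma row_setrow_neq r n (A : 'M[R]_(r, n)) i k b :
  k != i -> row k (setrow A i b) = row k A.
Proof. by move=> /negPf ki; apply/rowP => l; rewrite !mxE ki. Qed.

Lemma multilinear_setrow r n (w : 'M[R]_(r, n) -> R) A i (a : R) b c :
  multilinear w ->
  w (setrow A i (a *: b + c)) = a * w (setrow A i b) + w (setrow A i c).
Proof.
move=> mw; apply: (multilinearD (i := i)) => //.
- by rewrite !row_setrow.
- by move=> k ki; rewrite !row_setrow_neq.
- by move=> k ki; rewrite !row_setrow_neq.
Qed.

Lemma multilinear_setrow_sum r n (w : 'M[R]_(r, n) -> R) A i
    (I : finType) (a : I -> R) (b : I -> 'rV[R]_n) :
  multilinear w ->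
  w (setrow A i (\sum_k a k *: b k)) = \sum_k a k * w (setrow A i (b k)).
Proof.
move=> mw; elim/big_rec2: _ => [|k y x _ IH].
  by apply: (multilinear0 (i := i)) => //; rewrite row_setrow.
by rewrite multilinear_setrow // IH.
Qed.

(** Polarization: with [W] the dependence of [w] on the rows [i] and [j], expand
    [W (b + c) (b + c) = 0]. *)
Lemma alternating_tperm r n (w : 'M[R]_(r, n) -> R) i j v :
  multilinear w -> alternating w -> i != j ->
  w (row_perm (tperm i j) v) = - w v.
Proof.
move=> mw aw ij.
pose W b c := w (setrow (setrow v i b) j c).
have WD b b' c c' : W (b + b') (c + c') = W b c + W b c' + (W b' c + W b' c').
  have Dr b1 : W b1 (c + c') = W b1 c + W b1 c'.
    by rewrite /W -[c]scale1r multilinear_setrow // mul1r scale1r.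
  have sw (b1 c1 : 'rV_n) : setrow (setrow v i b1) j c1 = setrow (setrow v j c1) i b1.
    apply/matrixP => k l; rewrite !mxE; case: (eqVneq k j) => // ->.
    by rewrite eq_sym (negPf ij).
  have Dl c1 : W (b + b') c1 = W b c1 + W b' c1.
    by rewrite /W !sw -[b]scale1r multilinear_setrow // mul1r scale1r.
  by rewrite Dl !Dr.
have W0 b : W b b = 0.
  apply: (aw i j) => //; rewrite row_setrow row_setrow_neq //.
  by rewrite row_setrow.
have := WD (row i v) (row j v) (row i v) (row j v).
rewrite !W0 add0r addr0 => /eqP; rewrite eq_sym addr_eq0 => /eqP.
have -> : W (row i v) (row j v) = w v.
  by congr w; apply/matrixP => k l; rewrite !mxE; do 2![case: eqP => [->//|_]].
move=> ->; rewrite opprK; congr w; apply/matrixP => k l; rewrite !mxE.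
case: tpermP => [->|->|/eqP/negPf ki /eqP/negPf kj]; rewrite ?eqxx ?(negPf ij)//.
by rewrite ki kj.
Qed.

Lemma alternating_perm r n (w : 'M[R]_(r, n) -> R) (s : {perm 'I_r}) v :
  multilinear w -> alternating w -> w (row_perm s v) = (-1) ^+ s * w v.
Proof.
move=> mw aw; have [ts -> /=] := prod_tpermP s.
elim: ts v => [|[i j] ts IH] v /=.
  by rewrite big_nil odd_perm1 mul1r row_perm1.
move=> /andP[ij dts]; rewrite big_cons row_permM alternating_tperm //.
by rewrite IH // odd_permM odd_tperm /= (negPf ij) signrN mulNr.
Qed.

(** This sign rule makes the second derivatives cancel in the exterior differential of a
    pullback. *)
Lemma alternating_row' r n (w : 'M[R]_(r, n) -> R) (A : 'M[R]_(r.+1, n)) i j :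
  multilinear w -> alternating w -> i != j -> row i A = row j A ->
  (-1) ^+ i * w (row' i A) = - ((-1) ^+ j * w (row' j A)).
Proof.
move=> mw aw ij Aij.
(* Deleting the rows i and j of A gives matrices which differ by the permutation
   s of the rows obtained from tperm i j by deleting i |-> j, and the sign of s
   is (-1)^(i + j + 1). *)
pose f k := odflt k (unlift j (tperm i j (lift i k))).
have fE k : lift j (f k) = tperm i j (lift i k).
  rewrite /f; case: unliftP => //= Ej.
  have : lift i k = i by apply: (@perm_inj _ (tperm i j)); rewrite Ej tpermL.
  by move=> /eqP; rewrite eq_sym (negPf (neq_lift _ _)).
have finj : injective f.
  by move=> k l kl; apply: (@lift_inj _ i); apply: (@perm_inj _ (tperm i j)); rewrite -!fE kl.
pose s := perm finj.
have ls : lift_perm i j s = tperm i j.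
  apply/perm.permP => k; case: (unliftP i k) => [k' ->|->].
    by rewrite lift_perm_lift permE fE.
  by rewrite lift_perm_id tpermL.
have -> : row' i A = row_perm s (row' j A).
  apply/matrixP => k l; rewrite !mxE permE fE.
  have Ak m : A i m = A j m by have /rowP/(_ m) := Aij; rewrite !mxE.
  by case: tpermP => // ->; rewrite Ak.
rewrite alternating_perm // mulrA.
have := odd_lift_perm i j s; rewrite ls odd_tperm ij => E.
rewrite -signr_odd -[(-1) ^+ j]signr_odd -signr_addb -mulNr -signrN; congr (_ ^+ _ * _).
by move: E; do 3!case: odd; case: (odd_perm s).
Qed.

End Multilinear.

(** * Multilinear maps with variable arguments: smoothness and Leibniz rule *)

Section MultilinearDerivative.
Context {R : realType}.
Implicit Types (n m r : nat).
Local Notation consmx := (@col_mx _ 1 _ _).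

Lemma row'_col_mx r n (b : 'rV[R]_n) (B : 'M[R]_(r, n)) :
  row' (0 : 'I_r.+1) (col_mx b B : 'M[R]_(r.+1, n)) = B.
Proof.
apply/matrixP => k l; rewrite !mxE; case: splitP => j /=.
  by rewrite (ord1 j).
by rewrite /bump /= => /eqP; rewrite eqSS => /eqP/val_inj ->.
Qed.

Lemma row0_col_mx r n (b : 'rV[R]_n) (B : 'M[R]_(r, n)) :
  row (0 : 'I_r.+1) (col_mx b B : 'M[R]_(r.+1, n)) = b.
Proof. by apply/rowP => l; rewrite !mxE; case: splitP => // j _; rewrite (ord1 j). Qed.

Lemma rowS_col_mx r n (b : 'rV[R]_n) (B : 'M[R]_(r, n)) k :
  row (lift (0 : 'I_r.+1) k) (col_mx b B : 'M[R]_(r.+1, n)) = row k B.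
Proof. by rewrite -[in RHS](row'_col_mx b B); apply/rowP => l; rewrite ![LHS]mxE !mxE. Qed.

Lemma col_mx_row' r n (B : 'M[R]_(r.+1, n)) :
  B = col_mx (row 0 B) (row' (0 : 'I_r.+1) B).
Proof.
apply/row_matrixP => k; case: (unliftP 0 k) => [j ->|->].
  by rewrite [RHS]rowS_col_mx; apply/rowP => l; rewrite !mxE.
by rewrite [RHS]row0_col_mx.
Qed.

Lemma multilinear_col_mx r n (w : 'M[R]_(r.+1, n) -> R) (b : 'rV[R]_n) :
  multilinear w -> multilinear (fun B : 'M[R]_(r, n) => w (col_mx b B)).
Proof.
move=> mw i a t u v ti tu tv.
apply: (@multilinearD _ _ _ _ (lift 0 i) a _ _ _ mw).
- by rewrite !rowS_col_mx.
- move=> k; case: (unliftP 0 k) => [j ->|-> _]; rewrite ?row0_col_mx // !rowS_col_mx.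
  by move=> ji; apply: (eq_row' tu); apply: contra_neq ji => ->.
- move=> k; case: (unliftP 0 k) => [j ->|-> _]; rewrite ?row0_col_mx // !rowS_col_mx.
  by move=> ji; apply: (eq_row' tv); apply: contra_neq ji => ->.
Qed.

(** Expansion along the first row lowers the number of arguments by one; it is the induction step of
    the next two results. *)
Lemma multilinear_expand_row0 r n (w : 'M[R]_(r.+1, n) -> R) (B : 'M[R]_(r.+1, n)) :
  multilinear w ->
  w B = \sum_l B 0 l * w (consmx 'e_l (row' 0 B)).
Proof.
move=> mw; have {1}-> : B = setrow B 0 (\sum_l B 0 l *: 'e_l).
  apply/matrixP => k l; rewrite !mxE; case: eqP => // ->.
  rewrite summxE (bigD1 l) //= !mxE !eqxx mulr1 big1 ?addr0 // => j jl.
  by rewrite !mxE eqxx eq_sym (negPf jl) mulr0.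
rewrite multilinear_setrow_sum //; apply: eq_bigr => l _; congr (_ * w _).
apply/row_matrixP => k; case: (unliftP 0 k) => [j ->|->].
  rewrite rowS_col_mx row_setrow_neq 1?eq_sym ?neq_lift //.
  by apply/rowP => i; rewrite !mxE.
by rewrite row0_col_mx row_setrow.
Qed.

Lemma smooth_multilinear m n r (U : set 'rV[R]_m)
    (w : 'rV[R]_m -> 'M[R]_(r, n) -> R) (A : 'rV[R]_m -> 'M[R]_(r, n)) :
  open U -> (forall x, U x -> multilinear (w x)) ->
  (forall v, smooth U (fun x => w x v)) ->
  (forall k, smooth U (fun x => row k (A x))) ->
  smooth U (fun x => w x (A x)).
Proof.
move=> oU; elim: r w A => [|r IH] w A mw sw sA k.
  by apply: Ck_ext (sw 0 k) => // x _; rewrite (flatmx0 (A x)).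
apply: (@Ck_ext _ _ _ _ _ (fun x => \sum_l A x 0 l * w x (consmx 'e_l (row' 0 (A x))))).
- exact: oU.
- by move=> x Ux; rewrite -multilinear_expand_row0 //; exact: mw.
apply: Ck_sum => // l; apply: Ck_mul => //.
  by apply: Ck_ext (Ck_coord l oU (sA 0 k)) => // x _; rewrite mxE.
apply: (IH (fun x B => w x (consmx 'e_l B)) (fun x => row' 0 (A x))).
- by move=> x Ux; apply/multilinear_col_mx/mw.
- by move=> v; exact: sw.
- move=> j k'; apply: Ck_ext (sA (lift 0 j) k') => // x _.
  by apply/rowP => i; rewrite !mxE.
Qed.

(** Leibniz rule: one term for the dependence of [w] on the point, and one for each row of [A]. *)
Lemma is_derive_multilinear m n r (U : set 'rV[R]_m)
    (w : 'rV[R]_m -> 'M[R]_(r, n) -> R) (A : 'rV[R]_m -> 'M[R]_(r, n))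
    (x u : 'rV[R]_m) :
  open U -> (forall x, U x -> multilinear (w x)) ->
  (forall v, smooth U (fun x => w x v)) ->
  (forall k, smooth U (fun x => row k (A x))) -> U x ->
  is_derive x u (fun y => w y (A y))
    ('D_u (fun y => w y (A x)) x +
     \sum_k w x (setrow (A x) k ('D_u (fun y => row k (A y)) x))).
Proof.
move=> oU + + + Ux.
have nU : \forall y \near x, U y by exact: open_nbhs_nbhs.
elim: r w A => [|r IH] w A mw sw sA.
  rewrite big_ord0 addr0.
  have -> : (fun y => w y (A y)) = (fun y => w y (A x)).
    by apply/funext => y; rewrite (flatmx0 (A y)) (flatmx0 (A x)).
  by apply: derivableP; exact: smooth_derivable (sw _) Ux.
pose W l y (B : 'M[R]_(r, n)) := w y (consmx 'e_l B).
pose A' y := row' 0 (A y).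
have mW l y : U y -> multilinear (W l y) by move=> /mw; exact: multilinear_col_mx.
have sW l v : smooth U (fun y => W l y v) by exact: sw.
have sA' k : smooth U (fun y => row k (A' y)).
  move=> k'; apply: Ck_ext (sA (lift 0 k) k') => // y _.
  by apply/rowP => i; rewrite !mxE.
have dA' k : 'D_u (fun y => row k (A' y)) x = 'D_u (fun y => row (lift 0 k) (A y)) x.
  by congr ('D_u _ x); apply/funext => y; apply/rowP => i; rewrite !mxE.
have dA0 l : is_derive x u (fun y => A y 0 l) ('D_u (fun y => row 0 (A y)) x 0 l).
  have dr := smooth_derivable u (sA 0) Ux.
  have s0 : smooth U (fun y => A y 0 l).
    by move=> k; apply: Ck_ext (Ck_coord l oU (sA 0 k)) => // y _; rewrite mxE.
  split; first exact: smooth_derivable s0 Ux.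
  rewrite (derive_mx dr) mxE; congr ('D_u _ x).
  by apply/funext => y; rewrite mxE.
have dg l := is_deriveM (dA0 l) (IH (W l) A' (mW l) (sW l) sA').
apply: (@near_eq_is_derive _ _ _ (\sum_l ((fun y => A y 0 l) * (fun y => W l y (A' y))))).
  apply: filterS nU => y Uy; rewrite fct_sumE (multilinear_expand_row0 (A y) (mw y Uy)).
  by [].
apply: is_derive_eq (is_derive_sum dg) _.
(* [E1], [E2] and [E3] expand along row 0 the terms in which the derivative falls on [w], on row 0
   of [A] and on a later row, respectively. *)
have E1 : 'D_u (fun y => w y (A x)) x = \sum_l A x 0 l * 'D_u (fun y => W l y (A' x)) x.
  have dW l := is_deriveZ (A x 0 l) (derivableP (smooth_derivable u (sW l (A' x)) Ux)).
  suff [] : is_derive x u (fun y => w y (A x))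
    (\sum_l A x 0 l *: 'D_u (fun y => W l y (A' x)) x) by [].
  apply: near_eq_is_derive (is_derive_sum dW).
  apply: filterS nU => y Uy; rewrite fct_sumE (multilinear_expand_row0 (A x) (mw y Uy)).
  by [].
have E2 : w x (setrow (A x) 0 ('D_u (fun y => row 0 (A y)) x)) =
    \sum_l W l x (A' x) * 'D_u (fun y => row 0 (A y)) x 0 l.
  rewrite multilinear_expand_row0; last exact: mw.
  apply: eq_bigr => l _; rewrite mulrC mxE eqxx; congr (w x (consmx 'e_l _) * _).
  by apply/matrixP => i j; rewrite !mxE.
have E3 k b : w x (setrow (A x) (lift ord0 k) b) =
    \sum_l A x 0 l * W l x (setrow (A' x) k b).
  rewrite multilinear_expand_row0; last exact: mw.
  apply: eq_bigr => l _; rewrite mxE; congr (_ * w x (consmx 'e_l _)).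
  by apply/matrixP => i j; rewrite !mxE.
rewrite big_split /= big_ord_recl E1 E2 [RHS]addrCA addrC; congr (_ + _).
have -> : \sum_(k < r) w x (setrow (A x) (lift ord0 k)
      ('D_u (fun y => row (lift ord0 k) (A y)) x)) =
    \sum_(k < r) \sum_l A x 0 l *
      W l x (setrow (A' x) k ('D_u (fun y => row k (A' y)) x)).
  by apply: eq_bigr => k _; rewrite dA'; exact: E3.
rewrite exchange_big -big_split /=; apply: eq_bigr => l _.
by rewrite -mulr_sumr -mulrDr.
Qed.

End MultilinearDerivative.

(** * Pullback and exterior differential *)

Section Pullback.
Context {R : realType}.
Implicit Types (n m r : nat).

Lemma mul_jacobian m n (h : 'rV[R]_m -> 'rV[R]_n) x (u : 'rV[R]_m) :
  differentiable h x -> u *m jacobian h x = 'D_u h x.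
Proof. by move=> dh; rewrite deriveEjacobian. Qed.

Lemma row_mul_jacobian m n r (h : 'rV[R]_m -> 'rV[R]_n) x (v : 'M[R]_(r, m)) k :
  differentiable h x -> row k (v *m jacobian h x) = 'D_(row k v) h x.
Proof. by move=> dh; rewrite row_mul; exact: mul_jacobian. Qed.

Lemma eq_mulmx m n (A B : 'M[R]_(m, n)) : (forall u : 'rV[R]_m, u *m A = u *m B) -> A = B.
Proof. by move=> H; apply/row_matrixP => i; rewrite !rowE. Qed.

Lemma near_eq_jacobian m n (f g : 'rV[R]_m -> 'rV[R]_n) x :
  (\forall y \near x, f y = g y) -> differentiable f x ->
  jacobian f x = jacobian g x.
Proof.
move=> fg df; apply: eq_mulmx => u.
apply: (etrans (mul_jacobian u df)).
apply: (etrans (near_eq_derive u fg)); apply: esym.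
exact/mul_jacobian/(differentiable_near_eq fg df).
Qed.

Lemma jacobian_comp m n k (f : 'rV[R]_n -> 'rV[R]_k) (h : 'rV[R]_m -> 'rV[R]_n) x :
  differentiable h x -> differentiable f (h x) ->
  jacobian (f \o h) x = jacobian h x *m jacobian f (h x).
Proof.
move=> dh df; have dfh : differentiable (f \o h) x by exact: differentiable_comp.
apply: eq_mulmx => u; apply: (etrans (mul_jacobian u dfh)).
rewrite mulmxA (mul_jacobian u dh) (mul_jacobian _ df).
by rewrite (deriveE _ dfh) (deriveE _ dh) (deriveE _ df) diff_comp.
Qed.

Lemma derive_comp m n (W : normedModType R) (f : 'rV[R]_n -> W)
    (h : 'rV[R]_m -> 'rV[R]_n) x u :
  differentiable h x -> differentiable f (h x) ->
  'D_u (f \o h) x = 'D_('D_u h x) f (h x).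
Proof.
move=> dh df; rewrite !deriveE //; last exact: differentiable_comp.
by rewrite diff_comp.
Qed.

Lemma jacobian_id n (x : 'rV[R]_n) : jacobian (@idfun 'rV[R]_n) x = 1%:M.
Proof.
apply: eq_mulmx => u; rewrite mulmx1 mul_jacobian ?derive_id //.
Qed.

Lemma pullback_id n r (w : form n r) x v : pullback (@idfun 'rV[R]_n) w x v = w x v.
Proof. by rewrite /pullback jacobian_id mulmx1. Qed.

Lemma pullback_comp m n k r (f : 'rV[R]_n -> 'rV[R]_k) (h : 'rV[R]_m -> 'rV[R]_n)
    (w : form k r) x v :
  differentiable h x -> differentiable f (h x) ->
  pullback (f \o h) w x v = pullback h (pullback f w) x v.
Proof. by move=> dh df; rewrite /pullback jacobian_comp // mulmxA. Qed.

Lemma near_eq_pullback m n r (f g : 'rV[R]_m -> 'rV[R]_n) (w : form n r) x v :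
  (\forall y \near x, f y = g y) -> differentiable f x ->
  pullback f w x v = pullback g w x v.
Proof.
by move=> fg df; rewrite /pullback (near_eq_jacobian fg df) (nbhs_singleton fg).
Qed.

Lemma pullback_multilinear m n r (h : 'rV[R]_m -> 'rV[R]_n) (w : form n r) x :
  multilinear (w (h x)) -> multilinear (pullback h w x).
Proof.
move=> mw i a t u v ti tu tv; rewrite /pullback.
apply: (multilinearD (i := i) mw); first by rewrite !row_mul ti mulmxDl scalemxAl.
- by move=> k ki; rewrite !row_mul (eq_row' tu ki).
- by move=> k ki; rewrite !row_mul (eq_row' tv ki).
Qed.

Lemma pullback_alternating m n r (h : 'rV[R]_m -> 'rV[R]_n) (w : form n r) x :
  alternating (w (h x)) -> alternating (pullback h w x).
Proof. by move=> aw i j v ij vij; apply: (aw i j) => //; rewrite !row_mul vij. Qed.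

Section Smooth.
Variables (m n r : nat) (V : set 'rV[R]_m) (U : set 'rV[R]_n).
Variables (h : 'rV[R]_m -> 'rV[R]_n) (w : @form R n r).
Hypotheses (oV : open V) (oU : open U) (sh : smooth V h).
Hypotheses (VU : forall x, V x -> U (h x)) (fw : is_form U w).

Let sJ (v : 'M[R]_(r, m)) k : smooth V (fun x => row k (v *m jacobian h x)).
Proof.
move=> l; apply: Ck_ext (smooth_derive (row k v) sh l) => // x Vx.
by rewrite row_mul_jacobian //; exact: smooth_differentiable sh Vx.
Qed.

Let sw v : smooth V (fun x => w (h x) v).
Proof.
case: fw => _ _ s _ k.
exact: (Ck_comp_scalar oU oV VU (s v k) (sh k)).
Qed.

Let mw x : V x -> multilinear (w (h x)).
Proof. by move=> /VU; case: fw => + _ _ _; apply. Qed.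

Lemma pullback_smooth (v : 'M[R]_(r, m)) : smooth V (fun x => pullback h w x v).
Proof. exact: (smooth_multilinear oV mw sw (sJ v)). Qed.

(** The rows of [v *m jacobian h x] are directional derivatives of [h], so the Leibniz rule produces
    second derivatives of [h]. *)
Lemma is_derive_pullback (v : 'M[R]_(r, m)) (u x : 'rV[R]_m) : V x ->
  'D_u (fun y => pullback h w y v) x =
  'D_('D_u h x) (fun y => w y (v *m jacobian h x)) (h x) +
  \sum_k w (h x) (setrow (v *m jacobian h x) k ('D_u ('D_(row k v) h) x)).
Proof.
move=> Vx.
have [_ ->] := is_derive_multilinear u oV mw sw (sJ v) Vx.
have dh := smooth_differentiable sh Vx.
congr (_ + _).
  apply: (derive_comp (f := fun y => w y (v *m jacobian h x)) u dh).
  case: fw => _ _ s _; exact: smooth_differentiable (s _) (VU Vx).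
apply: eq_bigr => k _; congr (w _ (setrow _ _ _)); apply: near_eq_derive.
near=> y; rewrite row_mul_jacobian //; apply: smooth_differentiable sh _.
by near: y; exact: open_nbhs_nbhs.
Unshelve. all: by end_near. Qed.

End Smooth.

Lemma smooth_vector_derive_comm m n (V : set 'rV[R]_m) (h : 'rV[R]_m -> 'rV[R]_n)
    (x u v : 'rV[R]_m) :
  open V -> smooth V h -> V x -> 'D_u ('D_v h) x = 'D_v ('D_u h) x.
Proof.
move=> oV sh Vx.
have E u1 v1 j : 'D_u1 ('D_v1 h) x 0 j = 'D_u1 ('D_v1 (fun y => h y 0 j)) x.
  rewrite (derive_mx (smooth_derivable u1 (smooth_derive v1 sh) Vx)) mxE.
  apply: near_eq_derive; apply: filterS (open_nbhs_nbhs (conj oV Vx)) => y Vy.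
  by rewrite (derive_mx (smooth_derivable v1 sh Vy)) mxE.
apply/rowP => j.
have sj : smooth V (fun y => h y 0 j) by move=> k; exact: Ck_coord.
exact: (etrans (E u v j) (etrans (smooth_derive_comm u v oV sj Vx) (esym (E v u j)))).
Qed.

Lemma sum_antisymmetric r (G : 'I_r -> 'I_r -> R) :
  (forall i k, G i k = - G k i) -> \sum_i \sum_k G i k = 0.
Proof.
move=> GN; set S := LHS.
have : S = - S.
  rewrite {1}/S exchange_big /= -sumrN; apply: eq_bigr => i _.
  by rewrite -sumrN; apply: eq_bigr => k _.
by move/eqP; rewrite -subr_eq0 opprK -mulr2n mulrn_eq0 => /eqP.
Qed.

Lemma ext_diff_pullback m n r (V : set 'rV[R]_m) (U : set 'rV[R]_n)
    (h : 'rV[R]_m -> 'rV[R]_n) (w : form n r) x v :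
  open V -> open U -> smooth V h -> (forall x, V x -> U (h x)) -> is_form U w ->
  V x -> ext_diff V (pullback h w) x v = pullback h (ext_diff U w) x v.
Proof.
move=> oV oU sh VU fw Vx; have dh := smooth_differentiable sh Vx.
rewrite /pullback {1}/ext_diff asboolT // /ext_diff asboolT; last exact: VU.
pose J := jacobian h x.
have row'J i : row' i v *m J = row' i (v *m J).
  apply/row_matrixP => k; rewrite row_mul; apply/rowP => l; rewrite !mxE.
  by apply: eq_bigr => j _; rewrite !mxE.
pose B i k := 'D_(row i v) ('D_(row k v) h) x.
have BC i k : B i k = B k i by exact: (smooth_vector_derive_comm _ _ oV sh Vx).
(* The second derivatives B of h are symmetric, so that the terms in which
   they occur, collected in G, cancel in pairs. *)
pose G (i k : 'I_r.+1) := if i == k then 0 else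
  (-1) ^+ i * w (h x) (row' i (setrow (setrow (v *m J) k (B i k)) i (B i k))).
transitivity (\sum_(i < r.+1) ((-1) ^+ i *
    'D_(row i (v *m J)) (fun y => w y (row' i (v *m J))) (h x) + \sum_k G i k)).
  apply: eq_bigr => i _; rewrite (is_derive_pullback oV oU sh VU fw) // mulrDr row'J.
  rewrite row_mul_jacobian // (bigD1_ord i) //= {1}/G eqxx add0r; congr (_ + _).
  rewrite mulr_sumr; apply: eq_bigr => k _; rewrite /G (negPf (neq_lift _ _)).
  congr (_ * w _ _); apply/row_matrixP => l; apply/rowP => j.
  have -> : row k (row' i v) = row (lift i k) v by apply/rowP => a; rewrite !mxE.
  rewrite -/(B i (lift i k)) !mxE (inj_eq (@lift_inj _ i)).
  by rewrite [lift i l == i]eq_sym (negPf (neq_lift _ _)); case: eqP.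
rewrite big_split /= [X in _ + X]sum_antisymmetric ?addr0 // => i k.
rewrite /G [k == i]eq_sym; case: eqVneq => [_|ik]; first by rewrite oppr0.
case: fw => mw aw _ _.
have hU := VU _ Vx.
(* The row [i] set in [G i k] is deleted by [row' i]; it is given the value [B i k] only so that the
   rows [i] and [k] coincide here. *)
rewrite (alternating_row' (mw _ hU) (aw _ hU) ik); last first.
  by rewrite row_setrow row_setrow_neq 1?eq_sym // row_setrow.
rewrite BC; congr (- (_ * w _ _)); congr (row' (m := r.+1) _ _).
apply/matrixP => a b; rewrite !mxE; case: eqP => [->|//].
by case: eqP.
Qed.

Lemma near_eq_ext_diff n r (U U' : set 'rV[R]_n) (w w' : form n r) x v :
  U x -> U' x -> (forall u, \forall y \near x, w y u = w' y u) ->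
  ext_diff U w x v = ext_diff U' w' x v.
Proof.
move=> Ux U'x ww; rewrite /ext_diff !asboolT //; apply: eq_bigr => i _.
by congr (_ * _); exact: near_eq_derive.
Qed.

End Pullback.

(** * Bump functions *)

Section Bump.
Context {R : realType}.

Lemma smooth_id n (U : set 'rV[R]_n) : smooth U (@idfun 'rV[R]_n).
Proof.
move=> [|k]; first by move=> x _; exact: cvg_id.
split=> [x _|v]; first exact: ex_diff.
suff -> : 'D_v (@idfun 'rV[R]_n) = fun=> v by exact: Ck_cst.
by apply/funext => x; rewrite derive_id.
Qed.

(** The classical flat function exp(-1/t) times t^-k. The powers make the family stable under
    differentiation, up to linear combinations. *)
Definition flat (k : nat) (t : R) : R :=
  if 0 < t then t^-1 ^+ k * expR (- t^-1) else 0.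

(** For t > 0, exp(1/t) is at least (1/t)^(k+2) / (k+2)!. The square on the right makes the
    derivative at 0 vanish. *)
Lemma flat_bound k : exists2 C : R, 0 < C & forall t, `|flat k t| <= C * t ^+ 2.
Proof.
exists (k.+2)`!%:R => [|t]; first by rewrite ltr0n fact_gt0.
rewrite /flat; case: ifP => t0; last by rewrite normr0 mulr_ge0 // sqr_ge0.
have ti0 : 0 < t^-1 by rewrite invr_gt0.
rewrite ger0_norm; last by rewrite mulr_ge0 ?expR_ge0// exprn_ge0 // ltW.
rewrite expRN ler_pdivrMr ?expR_gt0 // -ler_pdivrMl; last first.
  by rewrite mulr_gt0 ?exprn_gt0 // ltr0n fact_gt0.
apply: le_trans (expR_ge1Dxn k.+1 (ltW ti0)).
rewrite invfM -exprVn -mulrA -exprD addnC mulrC.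
by rewrite -[leLHS]add0r lerD // addn2.
Qed.

Lemma is_derive_flat k t :
  is_derive t (1 : R) (flat k) (flat k.+2 t - k%:R * flat k.+1 t).
Proof.
case: (ltgtP 0 t) => [t0|t0|<-].
- have E : \forall s \near t, s^-1 ^+ k * expR (- s^-1) = flat k s.
    by near=> s; rewrite /flat ifT //; near: s; exact: lt_nbhsr.
  apply: near_eq_is_derive E _; rewrite /flat t0.
  have dV : is_derive t 1 (fun s : R => s^-1) (- t ^- 2).
    apply: is_derive_eq (@is_deriveV R id t 1 1 (lt0r_neq0 t0) (is_derive_id t 1)) _.
    by rewrite [LHS]mulr1.
  have dX := @is_deriveX _ _ _ k _ _ _ dV.
  have dE : is_derive t 1 (fun s : R => expR (- s^-1)) (t ^- 2 * expR (- t^-1)).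
    have dN := is_deriveN dV.
    have := @is_derive1_comp R expR (fun s => - s^-1) t _ _ (is_derive_expR (- t^-1)) dN.
    by rewrite opprK mulrC.
  have -> : (fun s : R => s^-1 ^+ k * expR (- s^-1)) =
      ((fun s : R => s^-1) ^+ k) * (fun s : R => expR (- s^-1)).
    by apply/funext => s; rewrite !fctE.
  apply: is_derive_eq (is_deriveM dX dE) _.
  have scE (a b : R) : a *: b = a * b by [].
  rewrite fctE -exprVn !scE.
  case: k {dX} => [|k] /=; first by ring.
  by rewrite !exprS; ring.
- have E : \forall s \near t, 0 = flat k s.
    by near=> s; rewrite /flat ifN // -leNgt ltW //; near: s; exact: lt_nbhsl.
  apply: near_eq_is_derive E _; rewrite /flat !ifN -?leNgt ?(ltW t0) // mulr0 subr0.
  exact: is_derive_cst.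
rewrite /flat ltxx mulr0 subr0 -/(flat k).
(* At 0 the difference quotient at [h] is at most [C * |h|] in absolute value. *)
have [C C0 flatC] := flat_bound k.
have cv : h^-1 *: ((flat k \o shift 0) (h *: 1) - flat k 0) @[h --> 0^'] --> (0 : R).
  apply/cvgrPdist_le => e e0; near=> h.
  have h0 : h != 0 by near: h; exact: nbhs_dnbhs_neq.
  rewrite /= addr0 [h *: 1]mulr1 {2}/flat ltxx subr0 sub0r normrN normrZ.
  have hC : `|h| <= e / C.
    near: h; apply: nbhs_dnbhs; apply/nbhs_ballP; exists (e / C); first exact: divr_gt0.
    by move=> y; rewrite /ball /= sub0r normrN => /ltW.
  rewrite normfV ler_pdivrMl ?normr_gt0 // (le_trans (flatC h)) //.
  rewrite -[h ^+ 2]ger0_norm ?sqr_ge0 // normrX expr2 mulrA mulrC ler_wpM2l //.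
  by rewrite mulrC -ler_pdivlMr.
by split; [exact: cvgP cv|exact: cvg_lim cv].
Unshelve. all: by end_near. Qed.

(** Induction on the order of differentiability, for all [k] at once, since differentiation raises
    [k] to [k.+1] and [k.+2]. *)
Lemma Ck_flat n (U : set 'rV[R]_n) (g : 'rV[R]_n -> R) k :
  open U -> smooth U g -> smooth U (fun x => flat k (g x)).
Proof.
move=> oU sg m; elim: m k => [|m IH] k.
  move=> x Ux; apply: (@continuous_comp _ _ _ g (flat k)); first exact: smooth_continuous sg Ux.
  have [d _] := is_derive_flat k (g x).
  exact/differentiable_continuous/derivable1_diffP.
have df t : differentiable (flat k) t.
  have [d _] := is_derive_flat k t; exact/derivable1_diffP.
split=> [x Ux|v].
  exact: (differentiable_comp (smooth_differentiable sg Ux) (df (g x))).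
apply: (@Ck_ext _ _ _ _ _ (fun x =>
  (1 *: flat k.+2 (g x) + (- k%:R) *: flat k.+1 (g x)) * 'D_v g x)) => //.
  move=> x Ux; rewrite (_ : (fun x => flat k (g x)) = flat k \o g) //.
  rewrite (deriveE _ (differentiable_comp (smooth_differentiable sg Ux) (df (g x)))).
  rewrite (diff_comp (smooth_differentiable sg Ux) (df (g x))) /=.
  rewrite -(deriveE _ (smooth_differentiable sg Ux)); move: ('D_v g x) => c.
  have -> : 'd (flat k) (g x) c = c *: 'd (flat k) (g x) 1.
    by rewrite -linearZ; congr ('d _ _ _); rewrite [RHS]mulr1.
  have [_ E] := is_derive_flat k (g x).
  move: E; rewrite (deriveE _ (df (g x))) => ->.
  have scE (a b : R) : a *: b = a * b by [].
  by rewrite !scE mul1r mulNr [RHS]mulrC.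
apply: Ck_mul => //; last exact: smooth_derive sg m.
have := Ck_lin (- k%:R) oU (IH k.+1) (IH k.+2); apply: Ck_ext => // x _.
by rewrite [LHS]addrC scale1r.
Qed.

(** The norm is the sup norm, so a product over the coordinates of one-variable bumps is supported
    in a ball; dividing by [flat 0 (e ^+ 2)] gives the value 1 at [x]. *)
Lemma bump_function n (x : 'rV[R]_n) (e : R) : 0 < e ->
  exists phi : 'rV[R]_n -> R,
    [/\ smooth setT phi, phi x = 1, forall y, `|phi y| <= 1 &
        forall y, phi y != 0 -> `|y - x| < e].
Proof.
move=> e0; pose g j (y : 'rV[R]_n) := e ^+ 2 - (y 0 j - x 0 j) ^+ 2.
have cE : flat 0 (e ^+ 2) != 0.
  by rewrite /flat exprn_gt0 // expr0 mul1r gt_eqF // expR_gt0.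
have sg j : smooth setT (g j).
  move=> k; have s1 : is_Ck setT k (fun y : 'rV[R]_n => y 0 j - x 0 j).
    have sid : is_Ck setT k (@idfun 'rV[R]_n) by exact: smooth_id.
    have := Ck_lin 1 openT (Ck_coord j openT sid) (Ck_cst k setT (- x 0 j)).
    by apply: (Ck_ext openT) => // y _; rewrite scale1r.
  have := Ck_lin (-1) openT (Ck_mul openT s1 s1) (Ck_cst k setT (e ^+ 2)).
  by apply: (Ck_ext openT) => // y _; rewrite scaleN1r addrC -expr2.
pose phi (s : seq 'I_n) y := \prod_(j <- s) (flat 0 (g j y) / flat 0 (e ^+ 2)).
have sphi s : smooth setT (phi s).
  elim: s => [|j s IH] k.
    have -> : phi [::] = fun=> 1 by apply/funext => y; rewrite /phi big_nil.
    exact: Ck_cst.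
  have -> : phi (j :: s) = fun y => flat 0 (g j y) * (flat 0 (e ^+ 2))^-1 * phi s y.
    by apply/funext => y; rewrite /phi big_cons.
  exact: Ck_mul openT (Ck_mul openT (Ck_flat 0 openT (sg j) k) (Ck_cst k setT _)) (IH k).
have flat_le s : s <= e ^+ 2 -> 0 <= flat 0 s <= flat 0 (e ^+ 2).
  rewrite /flat !expr0 !mul1r exprn_gt0 // => se.
  case: ifP => s0; last by rewrite lexx expR_ge0.
  by rewrite expR_ge0 ler_expR lerN2 lef_pV2 ?posrE ?exprn_gt0.
have c0 : 0 < flat 0 (e ^+ 2).
  by rewrite lt0r cE; have /andP[] := flat_le _ (lexx _).
exists (phi (index_enum 'I_n)); split=> //.
  rewrite /phi big1 // => j _; rewrite /g subrr expr0n /= subr0 divff //.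
  move=> y; have g01 j : 0 <= flat 0 (g j y) / flat 0 (e ^+ 2) <= 1.
    have /flat_le/andP[h0 h1] : g j y <= e ^+ 2 by rewrite /g gerBl sqr_ge0.
    by rewrite ler_pdivrMr // mul1r h1 divr_ge0 // ltW.
  rewrite ger0_norm /phi; last by apply: prodr_ge0 => j _; have /andP[] := g01 j.
  by apply: prodr_ile1 => j _; exact: g01.
move=> y; rewrite /phi prodf_seq_neq0 => /allP H.
rewrite [ltLHS]/Num.Def.normr/= mx_normrE; apply: bigmax_lt => //= -[i j] _ /=.
have := H j (mem_index_enum j); rewrite mulf_eq0 negb_or => /andP[+ _].
rewrite /flat; case: ifP => [gj _|]; last by rewrite eqxx.
rewrite !mxE (ord1 i) -(@ltr_pXn2r _ 2) ?nnegrE ?normr_ge0 ?(ltW e0) //.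
by move: gj; rewrite /g subr_gt0 real_normK ?num_real.
Qed.

End Bump.

(** * Charts and smooth maps *)

Section Charts.
Context {R : realType}.
Variables (n : nat) (M : @manifold R n).
Implicit Types (c : @chart R M n) (m k : nat).

Lemma chart_inv_dom c z : chart_img c z -> chart_dom c (chart_inv c z).
Proof. by move=> [x cx <-]; rewrite chart_mapK. Qed.

Lemma chart_invK c z : chart_img c z -> c (chart_inv c z) = z.
Proof. by move=> [x cx <-]; rewrite chart_mapK. Qed.

Lemma chart_img_map c x : chart_dom c x -> chart_img c (c x).
Proof. by move=> cx; exists x. Qed.

Lemma open_chart_img c : open (chart_img c).
Proof. exact: chart_img_open. Qed.
Arguments open_chart_img : clear implicits.

Lemma chart_inv_continuous_at c z : chart_img c z -> {for z, continuous (chart_inv c)}.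
Proof.
move=> cz; have := @chart_inv_continuous _ _ _ c.
by rewrite (continuous_open_subspace _ (open_chart_img c)); apply; rewrite inE.
Qed.

Lemma overlapP c c' z :
  overlap c c' z <-> chart_img c z /\ chart_dom c' (chart_inv c z).
Proof.
split=> [[x [cx c'x] <-]|[cz c'z]]; first by rewrite chart_mapK //; split=> //; exists x.
by exists (chart_inv c z); rewrite ?chart_invK //; split => //; exact: chart_inv_dom.
Qed.

Lemma overlap_open c c' : open (overlap c c').
Proof.
rewrite openE => z /overlapP[cz c'z].
have h1 : \forall y \near z, chart_img c y by exact: (open_nbhs_nbhs (conj (open_chart_img c) cz)).
have h2 : \forall y \near z, chart_dom c' (chart_inv c y).
  apply: (chart_inv_continuous_at cz); exact: (open_nbhs_nbhs (conj (chart_dom_open c') c'z)).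
by apply: filterS2 h1 h2 => y cy c'y; apply/overlapP.
Qed.

Arguments overlap_open : clear implicits.

Lemma transition_overlap c c' z : overlap c c' z -> overlap c' c (transition c c' z).
Proof.
move=> /overlapP[cz c'z]; apply/overlapP; rewrite /transition /=; split.
  exact: chart_img_map.
by rewrite chart_mapK //; exact: chart_inv_dom.
Qed.

Lemma transitionK c c' z : overlap c c' z -> transition c' c (transition c c' z) = z.
Proof.
by move=> /overlapP[cz c'z]; rewrite /transition /= chart_mapK // chart_invK.
Qed.

Lemma chart_inv_transition c c' z :
  overlap c c' z -> chart_inv c' (transition c c' z) = chart_inv c z.
Proof. by move=> /overlapP[cz c'z]; rewrite /transition /= chart_mapK. Qed.

Lemma smooth_local m (W : normedModType R) (U : set 'rV[R]_m) (f : 'rV[R]_m -> W) :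
  (forall x, U x -> exists V, open_nbhs x V /\ smooth V f) -> smooth U f.
Proof.
move=> H k; elim: k f H => [|k IH] f H.
  by move=> x /H[V [[oV Vx] /(_ 0%N)]]; apply.
split=> [x /H[V [[oV Vx] sf]]|v]; first exact: smooth_differentiable sf Vx.
by apply: IH => x /H[V [oV sf]]; exists V; split=> //; exact: smooth_derive.
Qed.

Lemma smooth_eq m (W : normedModType R) (U : set 'rV[R]_m) (f g : 'rV[R]_m -> W) :
  open U -> (forall x, U x -> f x = g x) -> smooth U f -> smooth U g.
Proof. by move=> oU fg sf k; exact: Ck_ext (sf k). Qed.

Lemma smooth_sub m (W : normedModType R) (U V : set 'rV[R]_m) (f : 'rV[R]_m -> W) :
  V `<=` U -> smooth U f -> smooth V f.
Proof. by move=> VU sf k; exact: Ck_sub (sf k). Qed.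

Lemma atlas_charts : atlas M `<=` charts M.
Proof. by move=> c ac c' ac'; exact: atlas_compatible. Qed.

(** Charts of the maximal atlas are by definition compatible with those of [atlas M] only; near each
    point the transition factors through one of the latter. *)
Lemma transition_smooth c c' :
  charts M c -> charts M c' -> smooth (overlap c c') (transition c c').
Proof.
move=> cc cc'; apply: smooth_local => z oz.
have /overlapP[cz c'z] := oz.
have [a aa az] := atlas_cover (chart_inv c z).
have ao : overlap c a z by apply/overlapP.
pose V := overlap c c' `&` overlap c a.
have oV : open V by apply: openI; exact: overlap_open.
exists V; split; first by [].
have [ca _] := cc a aa; have [_ ac'] := cc' a aa.
apply: (@smooth_eq _ _ _ (transition a c' \o transition c a)) => //.
  by move=> y [_ /overlapP[cy ay]]; rewrite /transition /= chart_mapK.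
apply: (smooth_comp (U := overlap a c')) => //; first exact: overlap_open.
- move=> y [/overlapP[cy c'y] /overlapP[_ ay]]; apply/overlapP; rewrite /transition /=.
  by split; [exact: chart_img_map|rewrite chart_mapK].
- by apply: smooth_sub ca => y [].
Qed.

(** [smooth_to] supplies one chart around [f x]; a transition map carries smoothness over to the
    given chart [c]. *)
Lemma smooth_to_chart m (V : set 'rV[R]_m) (f : 'rV[R]_m -> M) c x :
  smooth_to V f -> V x -> charts M c -> chart_dom c (f x) ->
  exists W, [/\ open_nbhs x W, W `<=` f @^-1` chart_dom c & smooth W (c \o f)].
Proof.
move=> sf Vx cc cfx; have [c0 [W0 [cc0 [oW0 W0x] W0f s0]]] := sf x Vx.
pose W := W0 `&` (c0 \o f) @^-1` overlap c0 c.
have oW : open W.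
  rewrite openE => y [W0y oy]; apply: filterI; first exact: (open_nbhs_nbhs (conj oW0 W0y)).
  apply: (smooth_continuous s0 W0y).
  exact: (open_nbhs_nbhs (conj (overlap_open c0 c) oy)).
exists W; split.
- split=> //; split=> //; apply/overlapP; rewrite /= chart_mapK; last exact: W0f.
  by split=> //; exact/chart_img_map/W0f.
- by move=> y [W0y /overlapP[_]] /=; rewrite chart_mapK //; exact: W0f.
- apply: (@smooth_eq _ _ _ (transition c0 c \o (c0 \o f))) => //.
    by move=> y [W0y _]; rewrite /transition /= chart_mapK //; exact: W0f.
  apply: (smooth_comp (U := overlap c0 c)) => //.
  + exact: overlap_open.
  + by move=> y [].
  + exact: transition_smooth.
  + by apply: smooth_sub s0 => y [].
Qed.

Lemma smooth_to_continuous m (V : set 'rV[R]_m) (f : 'rV[R]_m -> M) x :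
  smooth_to V f -> V x -> {for x, continuous f}.
Proof.
move=> sf Vx; have [c [W [cc [oW Wx] Wf sW]]] := sf x Vx.
have E : \forall y \near x, (chart_inv c \o (c \o f)) y = f y.
  apply: filterS (open_nbhs_nbhs (conj oW Wx)) => y Wy /=.
  by rewrite chart_mapK //; exact: Wf.
have fx : chart_dom c (f x) by exact: Wf.
suff : {for x, continuous (chart_inv c \o (c \o f))}.
  rewrite /prop_for /continuous_at (nbhs_singleton E) => h.
  by apply: cvg_trans h; exact: near_eq_cvg E.
apply: continuous_comp; first exact: smooth_continuous sW Wx.
exact/chart_inv_continuous_at/chart_img_map.
Qed.

Lemma pullback_chart_indep m r (w : mform_family M r) (V : set 'rV[R]_m)
    (f : 'rV[R]_m -> M) x v (c c' : chart_of M) :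
  is_mform w -> smooth_to V f -> V x ->
  chart_dom (sval c) (f x) -> chart_dom (sval c') (f x) ->
  pullback (sval c \o f) (w c) x v = pullback (sval c' \o f) (w c') x v.
Proof.
move=> [fw cw] sf Vx cx c'x.
have [W [[oW Wx] Wc sW]] := smooth_to_chart sf Vx (svalP c) cx.
have ox : overlap (sval c) (sval c') (sval c (f x)) by exists (f x).
have dcf := smooth_differentiable sW Wx.
have dt : differentiable (transition (sval c) (sval c')) ((sval c \o f) x).
  exact: smooth_differentiable (transition_smooth (svalP c) (svalP c')) ox.
have E : \forall y \near x, (transition (sval c) (sval c') \o (sval c \o f)) y
    = (sval c' \o f) y.
  apply: filterS (open_nbhs_nbhs (conj oW Wx)) => y Wy.
  by rewrite /transition /= chart_mapK //; exact: Wc.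
rewrite -(near_eq_pullback (w c') v E); last exact: differentiable_comp.
rewrite pullback_comp // {1 2}/pullback /=; exact: cw.
Qed.

End Charts.

Arguments open_chart_img {R n M} c.
Arguments overlap_open {R n M} c c'.

(** * Extension of tangent vectors to vector fields *)

Section VectorFields.
Context {R : realType}.

Lemma smooth_scale n m (U : set 'rV[R]_n) (g : 'rV[R]_n -> R) (f : 'rV[R]_n -> 'rV[R]_m) :
  open U -> smooth U g -> smooth U f -> smooth U (fun x => g x *: f x).
Proof.
move=> oU sg sf k; apply: Ck_row => // j.
have -> : (fun x => (g x *: f x) 0 j) = fun x => g x * f x 0 j.
  by apply/funext => x; rewrite mxE.
exact: Ck_mul oU (sg k) (Ck_coord j oU (sf k)).
Qed.

(** Compactness will make the image of the ball in the Hausdorff space [M] closed. *)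
Lemma closed_ball_sub n (U : set 'rV[R]_n) z : open U -> U z ->
  exists e : R, [/\ 0 < e, compact [set y : 'rV[R]_n | `|y - z| <= e] &
    [set y : 'rV[R]_n | `|y - z| <= e] `<=` U].
Proof.
move=> oU Uz; have := open_nbhs_nbhs (conj oU Uz).
move=> /nbhs_ballP[e /= e0 eU]; exists (e / 2); split.
- by rewrite divr_gt0.
- apply: bounded_closed_compact.
    exists (`|z| + e / 2); split; first exact: num_real.
    move=> x lx y /= yz; apply: le_trans (ltW lx).
    by rewrite -(subrK z y) (le_trans (ler_normD _ _)) // addrC lerD2l.
  have -> : [set y : 'rV[R]_n | `|y - z| <= e / 2] =
      (fun y : 'rV[R]_n => `|y - z|) @^-1` [set t | t <= e / 2] by [].
  apply: closed_comp; last exact: closed_le.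
  move=> y _; apply: (@continuous_comp _ _ _ (fun y : 'rV[R]_n => y - z) (fun y => `|y|)).
    exact: (cvgB cvg_id (cvg_cst _)).
  exact: norm_continuous.
- move=> y /= yz; apply: eU; rewrite -ball_normE /ball_ /= distrC.
  by apply: le_lt_trans yz _; rewrite ltr_pdivrMr // ltr_pMr // ltr1n.
Qed.

Section Extension.
Variables (n : nat) (M : @manifold R n) (c : chart_of M) (z a : 'rV[R]_n).
Variables (phi : 'rV[R]_n -> R) (e : R).
Hypotheses (sphi : smooth setT phi) (phiz : phi z = 1) (cz : cimg c z).
Hypotheses (phi0 : forall y, phi y != 0 -> `|y - z| < e).
Hypotheses (Ke : compact [set y : 'rV[R]_n | `|y - z| <= e])
  (Kc : [set y : 'rV[R]_n | `|y - z| <= e] `<=` cimg c).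

(* phi times the constant field a of the chart c, extended by 0 outside c. *)
Definition field_ext (c' : chart_of M) (y : 'rV[R]_n) : 'rV[R]_n :=
  if `[< overlap (sval c') (sval c) y >] then
    let y' := transition (sval c') (sval c) y in
    phi y' *: 'D_a (transition (sval c) (sval c')) y'
  else 0.

Let K : set M := chart_inv (sval c) @` [set y | `|y - z| <= e].

Let closedK : closed K.
Proof.
apply: compact_closed; first exact: carrier_hausdorff.
apply: continuous_compact Ke.
apply: continuous_subspaceW Kc _; exact: chart_inv_continuous.
Qed.

(** On the overlap with [c] the field has a smooth expression. A point off the overlap lies outside
    the closed set [K], and the field vanishes off [K]. *)
Lemma field_ext_smooth c' : smooth (cimg c') (field_ext c').
Proof.
apply: smooth_local => y c'y.
case: (pselect (overlap (sval c') (sval c) y)) => oy.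
  exists (overlap (sval c') (sval c)); split.
    by split=> //; exact: overlap_open.
  have st := transition_smooth (svalP c') (svalP c).
  have st' := transition_smooth (svalP c) (svalP c').
  have oo := overlap_open (sval c') (sval c).
  apply: (@smooth_eq _ _ _ _ (fun y => phi (transition (sval c') (sval c) y) *:
     ('D_a (transition (sval c) (sval c')) \o transition (sval c') (sval c)) y)) => //.
    by move=> x ox; rewrite /field_ext asboolT.
  apply: smooth_scale => //.
    by move=> k; exact: (Ck_comp_scalar openT oo (fun _ _ => I) (sphi k) (st k)).
  apply: smooth_comp (smooth_derive a st') st => //; first exact: overlap_open.
  exact: transition_overlap.
have nK : ~ K (chart_inv (sval c') y).
  move=> [x xe E]; apply: oy; apply/overlapP; split=> //.
  by rewrite -E; apply/chart_inv_dom/Kc.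
pose V := cimg c' `&` chart_inv (sval c') @^-1` (~` K).
have oV : open V.
  rewrite openE => x [c'x Kx]; apply: filterI.
    exact: (open_nbhs_nbhs (conj (open_chart_img (sval c')) c'x)).
  apply: (chart_inv_continuous_at c'x).
  by apply: open_nbhs_nbhs; split; [exact: closed_openC closedK|exact: Kx].
exists V; split=> //; apply: (@smooth_eq _ _ _ _ (fun=> 0)) => //.
  move=> x [c'x Kx]; rewrite /field_ext; case: asboolP => // ox /=.
  have [->|/phi0 xe] := eqVneq (phi (transition (sval c') (sval c) x)) 0.
    by rewrite scale0r.
  exfalso; apply: Kx; exists (transition (sval c') (sval c) x); first exact: ltW.
  by rewrite chart_inv_transition.
by move=> k; exact: Ck_cst.
Qed.

Lemma field_ext_change (c1 c2 : chart_of M) y : overlap (sval c1) (sval c2) y ->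
  field_ext c2 (transition (sval c1) (sval c2) y) =
  field_ext c1 y *m jacobian (transition (sval c1) (sval c2)) y.
Proof.
move=> o12; have /overlapP[c1y c2y] := o12; rewrite /field_ext.
have E : overlap (sval c2) (sval c) (transition (sval c1) (sval c2) y) <->
    overlap (sval c1) (sval c) y.
  rewrite !overlapP chart_inv_transition //; split=> -[_ cy]; split=> //.
  by rewrite /transition /=; exact: chart_img_map.
case: (pselect (overlap (sval c1) (sval c) y)) => o1; last first.
  by rewrite !asboolF ?mul0mx // E.
have o2 : overlap (sval c2) (sval c) (transition (sval c1) (sval c2) y) by apply/E.
rewrite !asboolT //=.
have E1 : transition (sval c2) (sval c) (transition (sval c1) (sval c2) y) =
    transition (sval c1) (sval c) y.
  by rewrite {1}/transition /= chart_inv_transition.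
rewrite E1 -scalemxAl; congr (_ *: _).
have o1' := transition_overlap o1.
set y' := transition (sval c1) (sval c) y.
have yE : transition (sval c) (sval c1) y' = y by exact: transitionK.
have d1 : differentiable (transition (sval c) (sval c1)) y'.
  exact: smooth_differentiable (transition_smooth (svalP c) (svalP c1)) o1'.
have d2 : differentiable (transition (sval c1) (sval c2)) (transition (sval c) (sval c1) y').
  by rewrite yE; exact: smooth_differentiable (transition_smooth (svalP c1) (svalP c2)) o12.
have Eo : \forall x \near y', (transition (sval c1) (sval c2) \o transition (sval c) (sval c1)) x
    = transition (sval c) (sval c2) x.
  apply: filterS (open_nbhs_nbhs (conj (overlap_open (sval c) (sval c1)) o1')) => x.
  by move=> ox; rewrite /transition /= chart_mapK //; have /overlapP[] := ox.
apply: etrans (esym (near_eq_derive a Eo)) _.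
apply: etrans (derive_comp a d1 d2) _.
apply: etrans (esym (mul_jacobian _ d2)) _.
by rewrite yE.
Qed.

Lemma field_ext_base : field_ext c z = a.
Proof.
have oz : overlap (sval c) (sval c) z by apply/overlapP; split=> //; exact: chart_inv_dom.
have tz : transition (sval c) (sval c) z = z by exact: chart_invK.
rewrite /field_ext asboolT //= tz phiz scale1r -[RHS](derive_id z a).
apply: near_eq_derive.
apply: filterS (open_nbhs_nbhs (conj (overlap_open (sval c) (sval c)) oz)) => x.
by move=> /overlapP[cx _]; rewrite /transition /= chart_invK.
Qed.

End Extension.

Lemma vector_field_ext n (M : @manifold R n) (c : chart_of M) (z a : 'rV[R]_n) :
  cimg c z -> exists phi : 'rV[R]_n -> R,
    is_vector_field (field_ext c a phi) /\ field_ext c a phi c z = a.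
Proof.
move=> cz; have [e [e0 Ke Kc]] := closed_ball_sub (open_chart_img (sval c)) cz.
have [phi [sphi phiz _ phi0]] := bump_function z e0.
exists phi; split; last exact: field_ext_base.
split; first by move=> c'; exact: field_ext_smooth sphi phi0 Ke Kc c'.
exact: field_ext_change.
Qed.

End VectorFields.

(** * Basic forms in foliated charts *)

Section FoliatedCharts.
Context {R : realType}.
Local Notation consmx := (@col_mx _ 1 _ _).

Lemma derive_locally_constant (V W : normedModType R) (f : V -> W) (x a : V) :
  (\forall h \near (0 : R), f (h *: a + x) = f x) -> 'D_a f x = 0.
Proof.
move=> H; apply/lim_near_cst => //; apply: nbhs_dnbhs.
by apply: filterS H => h /= ->; rewrite subrr scaler0.
Qed.

Lemma near_line (V : normedModType R) (U : set V) (x a : V) :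
  open U -> U x -> \forall h \near (0 : R), U (h *: a + x).
Proof.
move=> oU Ux.
have cf : {for (0 : R), continuous (fun h : R => h *: a + x)}.
  by apply: cvgD; [apply: cvgZr_tmp; exact: cvg_id|exact: cvg_cst].
by apply: cf; rewrite scale0r add0r; exact: open_nbhs_nbhs.
Qed.

Section Vertical.
Variables (p q : nat).
Implicit Types (a : 'rV[R]_(p + q)).

(** The rows of [u] are replaced by those of [v] one at a time; each replacement changes [w] by a
    term with a vertical row, which is 0. *)
Lemma multilinear_eq_transverse r (w : 'M[R]_(r, p + q) -> R) u v :
  multilinear w ->
  (forall i t, rsubmx (row i t) = 0 -> w t = 0) ->
  (forall i, rsubmx (row i u) = rsubmx (row i v)) -> w u = w v.
Proof.
move=> mw w0 uv.
pose mix k : 'M[R]_(r, p + q) := \matrix_(i, j) if (i < k)%N then v i j else u i j.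
have mixE k : w u = w (mix k).
  elim: k => [|k ->]; first by congr w; apply/matrixP => i j; rewrite mxE.
  have [kr|rk] := ltnP k r; last first.
    congr w; apply/matrixP => i j; rewrite !mxE ltnS.
    by rewrite (leq_trans (ltn_ord i) rk) (ltnW (leq_trans (ltn_ord i) rk)).
  pose i := Ordinal kr.
  rewrite (@multilinearD _ _ _ w i 1 (mix k) (mix k.+1)
    (setrow (mix k) i (row i u - row i v)) mw).
  - rewrite (w0 i (setrow _ _ _)) ?addr0 ?mul1r // row_setrow.
    by rewrite raddfB /= uv subrr.
  - rewrite row_setrow; apply/rowP => j; rewrite !mxE /= ltnn ltnSn.
    by rewrite mul1r addrC subrK.
  - move=> l li; apply/rowP => j; rewrite !mxE [in RHS]ltnS [in RHS]leq_eqVlt.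
    have /negPf -> // : l != k :> nat by apply: contra_neq li => lk; exact: val_inj.
  - by move=> l li; rewrite row_setrow_neq.
rewrite (mixE r); congr w; apply/matrixP => i j.
by rewrite mxE ltn_ord.
Qed.

Variables (M : @manifold R (p + q)) (F : foliation M).

(** Locally, the transverse part of a foliated transition depends on the transverse coordinate only,
    hence is constant on the line through [y] directed by [a]. *)
Lemma transition_vertical c c' y a :
  fatlas F c -> fatlas F c' -> overlap c c' y -> rsubmx a = 0 ->
  rsubmx ('D_a (transition c c') y) = 0.
Proof.
move=> cF c'F oy a0.
have [V [[oV Vy] Vo VE]] := fatlas_transition cF c'F oy.
have dt : derivable (transition c c') y a.
  exact: smooth_derivable (transition_smooth (fatlas_charts cF) (fatlas_charts c'F)) oy.
apply/rowP => j; rewrite mxE (derive_mx dt) !mxE.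
apply: derive_locally_constant.
apply: filterS (near_line a oV Vy) => h Vh.
have : rsubmx (h *: a + y) = rsubmx y by rewrite linearP /= a0 scaler0 add0r.
by move=> /(VE _ _ Vh Vy)/rowP/(_ j); rewrite !mxE.
Qed.

Lemma vertical_field (c : chart_of M) z a :
  fatlas F (sval c) -> cimg c z -> rsubmx a = 0 ->
  exists2 X, tangent_vector_field F X & X c z = a.
Proof.
move=> cF cz a0; have [phi [vX Xz]] := vector_field_ext a cz.
exists (field_ext c a phi) => //; split=> // c' y c'F c'y.
rewrite /field_ext; case: asboolP => [oy|_]; last by rewrite raddf0.
rewrite linearZ /= transition_vertical ?scaler0 //.
exact: transition_overlap.
Qed.

Lemma basic_is_form r (w : mform_family M r) (c : chart_of M) :
  basic_set F w -> is_form (cimg c) (w c).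
Proof. by case=> -[]. Qed.

(** Row [i] extends to a tangent field [X], and i_X w = 0. Contraction fills the first slot, so row
    [i] is first moved there by a transposition. *)
Lemma basic_vertical r (w : mform_family M r) (c : chart_of M) z i t :
  basic_set F w -> fatlas F (sval c) -> cimg c z -> rsubmx (row i t) = 0 -> w c z t = 0.
Proof.
case: r w i t => [|s] w i t bw cF cz ti; first by case: i ti.
case: (basic_is_form c bw) => /(_ z cz) mw /(_ z cz) aw _ _.
have [X tX Xz] := vertical_field cF cz ti.
have H v : w c z (consmx (row i t) v) = 0.
  by case: bw => _ /(_ X tX c z cz)[+ _] => /(_ v); rewrite /interior Xz.
have [i0|i0] := eqVneq 0 i.
  by rewrite (col_mx_row' t) i0; exact: H.
apply/eqP; rewrite -oppr_eq0 -(alternating_tperm _ mw aw i0).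
rewrite (col_mx_row' (row_perm _ t)).
have -> : row 0 (row_perm (tperm 0 i) t) = row i t.
  by apply/rowP => j; rewrite !mxE tpermL.
by rewrite H.
Qed.

(** In dw evaluated on [a] and [v], every term but the first differentiates a value of [w] having
    [a] among its arguments, which vanishes on the whole chart. *)
Lemma basic_derive_vertical r (w : mform_family M r) (c : chart_of M) z a
    (v : 'M[R]_(r, p + q)) :
  basic_set F w -> fatlas F (sval c) -> cimg c z -> rsubmx a = 0 ->
  'D_a (fun y => w c y v) z = 0.
Proof.
move=> bw cF cz a0; have [X tX Xz] := vertical_field cF cz a0.
have : ext_diff (cimg c) (w c) z (consmx a v) = 0.
  by case: bw => _ /(_ X tX c z cz)[_ /(_ v)]; rewrite /interior Xz.
rewrite /ext_diff asboolT // big_ord_recl /= expr0 mul1r row0_col_mx row'_col_mx.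
rewrite big1 ?addr0 // => k _; apply/eqP; rewrite mulf_eq0; apply/orP; right; apply/eqP.
apply: derive_locally_constant.
apply: filterS (near_line (row (lift ord0 k) (consmx a v)) (open_chart_img (sval c)) cz).
move=> h ch.
have E y : cimg c y -> w c y (row' (lift ord0 k) (consmx a v)) = 0.
  move=> cy; have [j jE] : exists j, lift (lift ord0 k) j = 0 :> 'I_r.+1.
    by case: (unliftP (lift ord0 k) 0) => [j ->|/eqP]; [exists j|rewrite (negPf (neq_lift _ _))].
  apply: (basic_vertical (i := j)) => //.
  have -> : row j (row' (lift ord0 k) (consmx a v)) = a; last by [].
  apply/rowP => l; rewrite !mxE; have := row0_col_mx a v.
  by rewrite -jE => /rowP/(_ l); rewrite !mxE.
by rewrite !E.
Qed.

(** By the vanishing of vertical derivatives, the coefficient is locally constant in the leaf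
    coordinate, which ranges over the connected set [P]. *)
Lemma basic_plaque r (w : mform_family M r) (c : chart_of M) z1 z2
    (v : 'M[R]_(r, p + q)) :
  basic_set F w -> fatlas F (sval c) -> cimg c z1 -> cimg c z2 -> rsubmx z1 = rsubmx z2 ->
  w c z1 v = w c z2 v.
Proof.
move=> bw cF; have [P [T [oP cP oT PT]]] := fatlas_product cF.
rewrite /cimg PT => -[P1 T1] [P2 T2] zz.
rewrite -(hsubmxK z1) -(hsubmxK z2) -zz.
set y := rsubmx z1 in zz T1 *; set x2 := lsubmx z2 in P2 *; set x1 := lsubmx z1 in P1 *.
pose g (x : 'rV[R]_p) := w c (row_mx x y) v.
have cin x : P x -> cimg c (row_mx x y).
  by move=> Px; rewrite /cimg PT /= row_mxKl row_mxKr.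
have loc x : P x -> exists V, open_nbhs x V /\ forall x', V x' -> P x' /\ g x' = g x.
  move=> Px; have := open_nbhs_nbhs (conj oP Px).
  move=> /nbhs_ballP[e /= e0 eP].
  exists (ball x e); split; first by split; [exact: ball_open|exact: ballxx].
  move=> x' xx'; split; first exact: eP.
  (* Balls are convex, so the mean value theorem applies on the segment from [x] to [x']. *)
  have inP s : 0 <= s <= 1 -> P (x + s *: (x' - x)).
    move=> /andP[s0 s1]; apply: eP; rewrite -ball_normE /ball_ /= opprD addrA subrr add0r normrN.
    rewrite normrZ ger0_norm //; apply: (@le_lt_trans _ _ `|x' - x|).
      by rewrite ler_piMl.
    by move: xx'; rewrite -ball_normE /ball_ /= distrC.
  pose a : 'rV[R]_(p + q) := row_mx (x' - x) 0.
  have lineE s : row_mx x y + s *: a = row_mx (x + s *: (x' - x)) y.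
    by rewrite scale_row_mx scaler0 add_row_mx addr0.
  have [_ _ sw _] := basic_is_form c bw.
  have [s|s s01] := @mean_value_line _ _ (fun z => w c z v) (row_mx x y) a 1 ltr01.
    by move=> s01; apply: smooth_derivable (sw v) _; rewrite lineE; exact/cin/inP.
  rewrite basic_derive_vertical ?mul0r //; last by rewrite row_mxKr.
    by rewrite lineE scale1r addrCA subrr addr0 => /eqP; rewrite subr_eq0 => /eqP.
  by rewrite lineE; exact/cin/inP.
have oA (Q : set R) : open [set x | P x /\ Q (g x)].
  rewrite openE => x [/loc[V [nV VP]] Qx].
  by apply: filterS (open_nbhs_nbhs nV) => x' /VP[Px' gx'] /=; rewrite gx'.
have AE : [set x | P x /\ g x = g x1] = P.
  apply: cP; first by exists x1.
  - exists [set x | P x /\ g x = g x1]; first exact: (oA [set s | s = g x1]).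
    by rewrite setIA setIid; apply/seteqP; split=> x []; split.
  - exists (~` [set x | P x /\ g x <> g x1]).
      by apply: open_closedC; exact: (oA [set s | s <> g x1]).
    apply/seteqP; split=> x /=; first by move=> [Px gx]; split => // -[_]; apply.
    by move=> [Px nx]; split=> //; apply: contrapT => gx; exact: nx.
by have : P x2 by []; rewrite -{1}AE => -[_]; rewrite /g => ->.
Qed.

End Vertical.

End FoliatedCharts.

(** * Pullback of basic forms along leaves *)

Section Pull.
Context {R : realType}.

Section Manifold.
Variables (n : nat) (M : @manifold R n).

Lemma smooth_to_comp m k (V : set 'rV[R]_m) (U : set 'rV[R]_k)
    (f : 'rV[R]_m -> M) (h : 'rV[R]_k -> 'rV[R]_m) :
  open U -> (forall x, U x -> V (h x)) -> smooth_to V f -> smooth U h ->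
  smooth_to U (f \o h).
Proof.
move=> oU UV sf sh x Ux; have [c [W [cc [oW Wx] Wf sW]]] := sf _ (UV x Ux).
have oUW : open (U `&` h @^-1` W).
  rewrite openE => y [Uy Wy]; apply: filterI; first exact: open_nbhs_nbhs.
  by apply: (smooth_continuous sh Uy); exact: open_nbhs_nbhs.
exists c, (U `&` h @^-1` W); split=> //.
- by move=> y [_ /Wf].
- rewrite -[c \o _]/((c \o f) \o h); apply: (smooth_comp oW oUW) => //.
  + by move=> y [].
  + by apply: smooth_sub sh => y [].
Qed.

Lemma smooth_to_sub m (V V' : set 'rV[R]_m) (f : 'rV[R]_m -> M) :
  open V' -> V' `<=` V -> smooth_to V f -> smooth_to V' f.
Proof.
move=> oV' V'V sf x V'x; have [c [W [cc [oW Wx] Wf sW]]] := sf x (V'V _ V'x).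
exists c, (W `&` V'); split=> //.
- by split; [exact: openI|split].
- by move=> y [/Wf].
- by apply: smooth_sub sW => y [].
Qed.

Lemma smooth_to_cst m (V : set 'rV[R]_m) (x0 : M) : smooth_to V (fun=> x0).
Proof.
move=> x _; have [c ac cm] := atlas_cover x0.
exists c, setT; split=> //; first exact: atlas_charts.
  by split=> //; exact: openT.
by move=> k; exact: Ck_cst.
Qed.

Lemma chart_inv_smooth_to (c : chart_of M) : smooth_to (cimg c) (chart_inv (sval c)).
Proof.
move=> z cz; exists (sval c), (cimg c); split.
- exact: svalP.
- by split=> //; exact: open_chart_img.
- by move=> y; exact: chart_inv_dom.
- apply: (@smooth_eq _ _ _ _ (@idfun 'rV[R]_n)); first exact: open_chart_img.
    by move=> y cy /=; rewrite chart_invK.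
  exact: smooth_id.
Qed.

Lemma chart_at_subproof (y : M) : {c : chart_of M | chart_dom (sval c) y}.
Proof.
apply: cid; have [c ac cy] := atlas_cover y.
by exists (exist _ c (atlas_charts ac)).
Qed.

Definition chart_at (y : M) : chart_of M := sval (chart_at_subproof y).

Lemma chart_atP y : chart_dom (sval (chart_at y)) y.
Proof. exact: svalP (chart_at_subproof y). Qed.

(* The pullback of w by f, read in an arbitrary chart around f x. *)
Definition pull r (w : mform_family M r) m (f : 'rV[R]_m -> M) : form m r :=
  fun x v => pullback (sval (chart_at (f x)) \o f) (w (chart_at (f x))) x v.

Lemma pullE r (w : mform_family M r) m (V : set 'rV[R]_m) (f : 'rV[R]_m -> M)
    (c : chart_of M) x v :
  is_mform w -> smooth_to V f -> V x -> chart_dom (sval c) (f x) ->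
  pull w f x v = pullback (sval c \o f) (w c) x v.
Proof. by move=> mw sf Vx cx; apply: pullback_chart_indep sf _ _ _ => //; exact: chart_atP. Qed.

(** Both sides use the same chart, chosen at [f (h x)], so only the chain rule is at stake. *)
Lemma pull_comp r (w : mform_family M r) m k (V : set 'rV[R]_m) (U : set 'rV[R]_k)
    (f : 'rV[R]_m -> M) (h : 'rV[R]_k -> 'rV[R]_m) x v :
  is_mform w -> open U -> (forall x, U x -> V (h x)) -> smooth_to V f -> smooth U h ->
  U x -> pull w (f \o h) x v = pull w f (h x) (v *m jacobian h x).
Proof.
move=> mw oU UV sf sh Ux.
have [W [[oW Wx] _ sW]] :=
  smooth_to_chart sf (UV _ Ux) (svalP (chart_at (f (h x)))) (chart_atP (f (h x))).
exact: (pullback_comp (f := sval (chart_at (f (h x))) \o f) (w (chart_at (f (h x)))) v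
  (smooth_differentiable sh Ux) (smooth_differentiable sW Wx)).
Qed.

End Manifold.

Section Foliation.
Variables (p q : nat) (M : @manifold R (p + q)) (F : foliation M).

Lemma near_eq_rsubmx_jacobian m r (f g : 'rV[R]_m -> 'rV[R]_(p + q)) x
    (v : 'M[R]_(r, m)) i :
  differentiable f x -> differentiable g x ->
  (\forall y \near x, rsubmx (f y) = rsubmx (g y)) ->
  rsubmx (row i (v *m jacobian f x)) = rsubmx (row i (v *m jacobian g x)).
Proof.
move=> df dg fg.
apply: etrans (congr1 rsubmx (row_mul_jacobian v i df)) _.
apply: etrans _ (esym (congr1 rsubmx (row_mul_jacobian v i dg))).
have E h : differentiable h x -> rsubmx ('D_(row i v) h x) =
    \row_j 'D_(row i v) (fun y => (h y : 'rV[R]_(p + q)) 0 (rshift p j)) x.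
  move=> dh; apply/rowP => j; rewrite [LHS]mxE [RHS]mxE.
  by rewrite (derive_mx (diff_derivable (v := row i v) dh)) mxE.
apply: etrans (E f df) _; apply: etrans _ (esym (E g dg)).
apply/rowP => j; rewrite [LHS]mxE [RHS]mxE; apply: near_eq_derive.
by apply: filterS fg => y /= /rowP/(_ j); rewrite !mxE.
Qed.

(** The coefficients of [w] agree at [f x] and [g x], which lie on one plaque, and the differentials
    of [f] and [g] differ by vertical vectors, which [w] kills. *)
Lemma transverse_eq_pull r (w : mform_family M r) m (V : set 'rV[R]_m)
    (f g : 'rV[R]_m -> M) (c : chart_of M) x v :
  basic_set F w -> smooth_to V f -> smooth_to V g -> V x ->
  fatlas F (sval c) -> chart_dom (sval c) (f x) -> chart_dom (sval c) (g x) ->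
  (\forall y \near x, rsubmx (sval c (f y)) = rsubmx (sval c (g y))) ->
  pull w f x v = pull w g x v.
Proof.
move=> bw sf sg Vx cF cf cg fg; have mw : is_mform w by case: bw.
rewrite (pullE v mw sf Vx cf) (pullE v mw sg Vx cg) /pullback /=.
have [Wf [[oWf Wfx] _ sWf]] := smooth_to_chart sf Vx (svalP c) cf.
have [Wg [[oWg Wgx] _ sWg]] := smooth_to_chart sg Vx (svalP c) cg.
have df := smooth_differentiable sWf Wfx; have dg := smooth_differentiable sWg Wgx.
have cgx : cimg c (sval c (g x)) by exact: chart_img_map.
rewrite (basic_plaque _ bw cF (chart_img_map cf) cgx (nbhs_singleton fg)).
have [mwc _ _ _] := basic_is_form c bw.
apply: multilinear_eq_transverse; first exact: mwc.
  by move=> i t; exact: (basic_vertical bw cF cgx).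
by move=> i; exact: near_eq_rsubmx_jacobian.
Qed.

Lemma same_leaf_germ m (V : set 'rV[R]_m) (f : 'rV[R]_m -> M) x z :
  open_nbhs x V -> smooth_to V f -> same_leaf F (f x) z ->
  exists V' (g : 'rV[R]_m -> M), [/\ open_nbhs x V', V' `<=` V, smooth_to V' g, g x = z &
    (forall y, V' y -> leaf_proj F (f y) = leaf_proj F (g y)) /\
    forall r (w : mform_family M r) v, basic_set F w -> pull w f x v = pull w g x v].
Proof.
(* Stated for all germs, so that it can be proved by induction on the chain of
   plaques from f x to z. In one plaque, f is translated in the chart. *)
pose move_germ z1 z2 := forall V f, open_nbhs x V -> smooth_to V f -> f x = z1 ->
  exists V' (g : 'rV[R]_m -> M), [/\ open_nbhs x V', V' `<=` V, smooth_to V' g, g x = z2 &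
    (forall y, V' y -> leaf_proj F (f y) = leaf_proj F (g y)) /\
    forall r (w : mform_family M r) v, basic_set F w -> pull w f x v = pull w g x v].
(* Both directions are carried along because [same_leaf] is a symmetric closure. *)
suff H z1 z2 : same_leaf F z1 z2 -> move_germ z1 z2 /\ move_germ z2 z1.
  by move=> nV sf /H[h _]; exact: h.
have plaque a b : same_plaque F a b -> move_germ a b.
  move=> [c cF [ca cb ab]] {}V {}f [oV Vx] sf fx.
  pose c' : chart_of M := exist _ c (fatlas_charts cF).
  have cfx : chart_dom c (f x) by rewrite fx.
  have [W0 [[oW0 W0x] W0f sW0]] := smooth_to_chart sf Vx (fatlas_charts cF) cfx.
  pose W := W0 `&` V.
  have oW : open W by exact: openI.
  have sW : smooth W (c \o f) by apply: smooth_sub sW0 => y [].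
  pose d := c b - c a.
  have d0 : rsubmx d = 0 by rewrite raddfB /= ab subrr.
  pose h y := c (f y) + d.
  have sh : smooth W h.
    move=> k; have := Ck_lin 1 oW (sW k) (Ck_cst k W d).
    by apply: Ck_ext => // y _; rewrite scale1r.
  (* The translate may leave the image of the chart, whence this smaller neighbourhood. *)
  pose V' := W `&` h @^-1` chart_img c.
  have oV' : open V'.
    rewrite openE => y [Wy hy]; apply: filterI; first exact: open_nbhs_nbhs.
    apply: (smooth_continuous sh Wy).
    by apply: open_nbhs_nbhs; split=> //; exact: open_chart_img.
  have hx : h x = c b by rewrite /h fx /d addrC subrK.
  have V'x : V' x by split; [split|rewrite /= hx; exact: chart_img_map].
  have sg : smooth_to V' (chart_inv c \o h).
    apply: (smooth_to_comp (V := cimg c') oV'); first by move=> y [].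
      exact: chart_inv_smooth_to.
    by apply: smooth_sub sh => y [].
  have rE y : V' y -> rsubmx (c (f y)) = rsubmx (c ((chart_inv c \o h) y)).
    by move=> [_ hy] /=; rewrite chart_invK // raddfD /= d0 addr0.
  exists V', (chart_inv c \o h).
  split; [by split|by move=> y [[]]|exact: sg|by rewrite /= hx chart_mapK|].
  split=> [y V'y|r w v bw].
    apply/eqmodP/asboolP; apply: Relation_Operators.rst_step; exists c => //; split.
    + by case: V'y => -[/W0f].
    + by case: V'y => _; exact: chart_inv_dom.
    + exact: rE.
  have sf' : smooth_to V' f by apply: smooth_to_sub sf => // y [[]].
  apply: (@transverse_eq_pull _ _ _ V' _ _ c' _ _ bw sf' sg V'x) => //.
    by case: V'x => _; exact: chart_inv_dom.
  exact: filterS rE (open_nbhs_nbhs (conj oV' V'x)).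
have plaque_sym a b : same_plaque F a b -> same_plaque F b a.
  by move=> [c cF [ca cb ab]]; exists c.
elim=> {z1 z2} [a b ab|a|a b _ [ab ba]|a b c _ [ab ba] _ [bc cb]].
- by split; [exact: plaque|exact/plaque/plaque_sym].
- have h : move_germ a a.
    by move=> V1 f1 nV sf fx; exists V1, f1; split; [exact: nV| |exact: sf|exact: fx|split].
  by split; exact: h.
- by split; [exact: ba|exact: ab].
have trans a1 b1 c1 : move_germ a1 b1 -> move_germ b1 c1 -> move_germ a1 c1.
  move=> h1 h2 V1 f1 nV1 sf1 f1x.
  have [V2 [f2 [nV2 V21 sf2 f2x [l2 p2]]]] := h1 V1 f1 nV1 sf1 f1x.
  have [V3 [f3 [nV3 V32 sf3 f3x [l3 p3]]]] := h2 V2 f2 nV2 sf2 f2x.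
  exists V3, f3; split; [exact: nV3|by move=> y /V32/V21|exact: sf3|exact: f3x|].
  split=> [y V3y|r w v bw]; first by rewrite l2 ?l3 //; exact: V32.
  by rewrite (p2 r w v bw) (p3 r w v bw).
by split; [exact: trans ab bc|exact: trans cb ba].
Qed.

End Foliation.

End Pull.

(** * The tubular property *)

Section EuclideanManifold.
Context {R : realType}.
Variable m : nat.

Lemma row_vector_second_countable : @second_countable 'rV[R]_m.
Proof.
pose B (qk : 'rV[rat]_m * nat) : set 'rV[R]_m :=
  ball (map_mx ratr qk.1 : 'rV[R]_m) (qk.2.+1%:R^-1).
exists (B @` setT).
  by apply: (sub_countable (card_image_le B setT)); exact: countableP.
split=> [_ [qk _ <-]|x]; first exact: ball_open.
move=> V /nbhs_ballP[e /= e0 eV].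
have [k ke] : exists k, k.+1%:R^-1 < e / 2.
  have e2 : 0 < (e / 2)^-1 by rewrite invr_gt0 divr_gt0.
  have := archi_boundP (ltW e2); set N := Num.bound _ => eN.
  exists N; rewrite invf_plt ?posrE ?ltr0n ?divr_gt0 //.
  by apply: lt_trans eN _; rewrite ltr_nat.
have k0 : 0 < k.+1%:R^-1 :> R by rewrite invr_gt0 ltr0n.
have Q i : {a : rat | (ratr a : R) \in `]x 0 i - k.+1%:R^-1, x 0 i + k.+1%:R^-1[%R}.
  have h : x 0 i - k.+1%:R^-1 < x 0 i + k.+1%:R^-1 by rewrite ltrD2l gtrN.
  exact: cid (rat_in_itvoo h).
pose u : 'rV[rat]_m := \row_i sval (Q i).
have xu : B (u, k) x.
  split; first exact: k0.
  move=> i j; rewrite (ord1 i) !mxE /ball /=.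
  have := svalP (Q j); rewrite in_itv /= => /andP[h1 h2].
  by rewrite ltr_distl h1 h2.
exists (B (u, k)); first by split; [exists (u, k)|exact: xu].
move=> y uy; apply: eV; apply: (@le_ball _ _ _ (k.+1%:R^-1 + k.+1%:R^-1)).
  by rewrite [leRHS]splitr lerD // ltW.
exact: ball_triangle (ball_sym xu) uy.
Qed.

Let id_within (A : set 'rV[R]_m) : {within A, continuous (@idfun 'rV[R]_m)}.
Proof. by apply: continuous_subspaceT => x; exact: cvg_id. Qed.

Let open_id_image : open ((@idfun 'rV[R]_m) @` setT).
Proof. by rewrite image_id; exact: openT. Qed.

Definition id_chart : @chart R 'rV[R]_m m :=
  @Chart R _ m setT idfun idfun openT open_id_image (fun _ _ => erefl)
    (@id_within _) (@id_within _).

Lemma id_chart_compatible : compatible id_chart id_chart.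
Proof. by split; exact: smooth_id. Qed.

(** The tubular property concerns maps defined on manifolds; it will be applied with this manifold
    as source. *)
Definition euclidean : @manifold R m.
refine (@Manifold R m 'rV[R]_m [set id_chart] (@norm_hausdorff _ _)
  row_vector_second_countable _ _).
- by move=> x; exists id_chart.
- by move=> c c' -> ->; exact: id_chart_compatible.
Defined.

Lemma euclidean_smooth_map n (M : @manifold R n) (f : 'rV[R]_m -> M) :
  smooth_to setT f -> smooth_map (X := euclidean) f.
Proof.
move=> sf c cc; apply: smooth_to_comp sf _ => //; first exact: (open_chart_img (M := euclidean)).
have [+ _] := cc id_chart erefl; apply: smooth_sub => z cz.
by apply/(overlapP (M := euclidean)).
Qed.

(** Take [rho y = x + phi y *: (y - x)] with [phi] a bump at [x]. The derivative of [phi] is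
    multiplied by [y - x], so it does not contribute at [x]. *)
Lemma retraction (V : set 'rV[R]_m) (x : 'rV[R]_m) : open_nbhs x V ->
  exists rho : 'rV[R]_m -> 'rV[R]_m, [/\ smooth setT rho, forall y, V (rho y),
    rho x = x & jacobian rho x = 1%:M].
Proof.
move=> [oV Vx]; have := open_nbhs_nbhs (conj oV Vx).
move=> /nbhs_ballP[e /= e0 eV].
have [phi [sphi phix phi1 phi0]] := bump_function x e0.
pose sub y : 'rV[R]_m := y - x.
have ssub : smooth setT sub.
  move=> k; have := Ck_lin 1 openT (@smooth_id R m setT k) (Ck_cst k setT (- x)).
  by apply: (Ck_ext openT) => y _; rewrite scale1r.
have sprod : smooth setT (fun y => phi y *: sub y) by exact: smooth_scale openT sphi ssub.
pose rho y := x + phi y *: sub y.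
have srho : smooth setT rho.
  move=> k; have := Ck_lin 1 openT (sprod k) (Ck_cst k setT x).
  by apply: (Ck_ext openT) => y _; rewrite scale1r addrC.
have rx : rho x = x by rewrite /rho /sub subrr scaler0 addr0.
exists rho; split=> //.
  move=> y; apply: eV; rewrite -ball_normE /ball_ /= /rho opprD addrA subrr add0r normrN.
  rewrite normrZ; have [->|/phi0 ye] := eqVneq (phi y) 0; first by rewrite normr0 mul0r.
  by apply: le_lt_trans ye; rewrite ler_piMl.
apply: eq_mulmx => u; rewrite mulmx1.
apply: etrans (mul_jacobian u (smooth_differentiable srho (I : setT x))) _.
apply/rowP => j.
rewrite (derive_mx (smooth_derivable u srho (I : setT x))) mxE.
have d1 : is_derive x u phi ('D_u phi x) := derivableP (smooth_derivable u sphi (I : setT x)).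
have d2 : is_derive x u (fun y => sub y 0 j) (u 0 j).
  have ds := smooth_derivable u ssub (I : setT x).
  have sj : smooth setT (fun y => sub y 0 j) by move=> k; exact: Ck_coord openT (ssub k).
  split; first exact: (smooth_derivable u sj (I : setT x)).
  have : 'D_u sub x = u.
    have [_ ->] := is_deriveB (is_derive_id x u) (is_derive_cst x x u).
    by rewrite subr0.
  by rewrite (derive_mx ds) => /rowP/(_ j); rewrite mxE.
have d3 := is_deriveD (is_derive_cst (x 0 j) x u) (is_deriveM d1 d2).
have -> : (fun y => rho y 0 j) = (fun=> x 0 j) + phi * (fun y => sub y 0 j).
  by apply/funext => y; rewrite !fctE !mxE.
have [_ ->] := d3.
by rewrite add0r /sub mxE [(- x) 0 j]mxE subrr scale0r addr0 phix scale1r.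
Qed.

End EuclideanManifold.

(** * Functions with zero derivative on [0,1], one-sided at the end points *)

Section ZeroDerivative.
Context {R : realType}.

Lemma zero_derivative_segment (f : R -> R) :
  (forall t, 0 <= t <= 1 ->
    (fun s => (s - t)^-1 * (f s - f t)) @ within [set s | 0 <= s <= 1] t^' --> (0 : R)) ->
  f 0 = f 1.
Proof.
move=> H.
pose k (s : R) := Num.max 0 (Num.min 1 s).
have kI s : 0 <= k s <= 1 by rewrite /k le_max lexx /= ge_max ler01 ge_min lexx.
have kid s : 0 <= s <= 1 -> k s = s.
  by move=> /andP[s0 s1]; rewrite /k (min_r s1) (max_r s0).
have k0 s : s <= 0 -> k s = 0.
  by move=> s0; rewrite /k min_r ?(le_trans s0) // max_l.
have k1 s : 1 <= s -> k s = 1.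
  by move=> s1; rewrite /k min_l // max_r.
(* Hence the difference quotients of [f \o k] are bounded by those of [f]. *)
have kl s t : 0 <= t <= 1 -> `|k s - t| <= `|s - t|.
  move=> /andP[t0 t1]; have [s0|s0] := leP s 0.
    by rewrite k0 // !ler0_norm ?subr_le0 ?(le_trans s0) // lerN2 lerD2r.
  have [s1|s1] := leP 1 s.
    by rewrite k1 // !ger0_norm ?subr_ge0 ?(le_trans t1) // lerD2r.
  by rewrite kid // (ltW s0) (ltW s1).
(* f is extended to R by constants by means of the projection k to [0,1]; the
   derivative of f o k is 0 at every point of R. *)
suff D (x0 : R) : is_derive x0 (1 : R) (f \o k) 0.
  by have := is_derive_0_is_cst 0 1 D; rewrite /= !kid ?lexx ?ler01.
have [x00|x00] := ltP x0 0.
  have E : \forall s \near x0, cst (f 0) s = (f \o k) s.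
    by apply: filterS (lt_nbhsl x00) => s s0 /=; rewrite k0 // ltW.
  exact: near_eq_is_derive E (is_derive_cst _ _ _).
have [x01|x01] := ltP 1 x0.
  have E : \forall s \near x0, cst (f 1) s = (f \o k) s.
    by apply: filterS (lt_nbhsr x01) => s s0 /=; rewrite k1 // ltW.
  exact: near_eq_is_derive E (is_derive_cst _ _ _).
have xI : 0 <= x0 <= 1 by rewrite x00 x01.
have cv : h^-1 *: (((f \o k) \o shift x0) (h *: 1) - (f \o k) x0) @[h --> 0^'] --> (0 : R).
  apply/cvgrPdist_le => e e0.
  have /cvgrPdist_le/(_ e e0) := H x0 xI.
  rewrite near_withinE => -[d /= d0 dH].
  near=> h.
  have hd : `|h| < d.
    near: h; apply: nbhs_dnbhs; apply/nbhs_ballP; exists d => //.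
    by move=> y; rewrite /ball /= sub0r normrN.
  have h0 : h != 0 by near: h; exact: nbhs_dnbhs_neq.
  rewrite sub0r normrN normrZ [h *: 1]mulr1 /= (kid x0) //.
  have := kl (h + x0) x0 xI; rewrite addrK => kh.
  rewrite normfV ler_pdivrMl ?normr_gt0 // mulrC.
  have [->|kx] := eqVneq (k (h + x0)) x0; first by rewrite subrr normr0 mulr_ge0 // ltW.
  have bk : ball x0 d (k (h + x0)) by rewrite /ball /= distrC (le_lt_trans kh).
  have := dH _ bk kx (kI _); rewrite sub0r normrN normrM normfV.
  rewrite ler_pdivrMl ?normr_gt0 ?subr_eq0 // => h1; apply: (le_trans h1).
  by rewrite [leLHS]mulrC; apply: ler_wpM2l kh; exact: ltW.
by split; [exact: cvgP cv|exact: cvg_lim cv].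
Unshelve. all: by end_near. Qed.

End ZeroDerivative.

(** * Consequences of the tubular property for pullbacks of basic forms *)

Section TubularProperty.
Context {R : realType}.
Variables (p q : nat) (M : @manifold R (p + q)) (F : foliation M).

Lemma constant_tangential (x0 : M) : tangential_path F (fun=> x0).
Proof.
split=> [t _|c t _ _ _].
  exists setT, (fun=> x0); split=> //; last exact: smooth_to_cst.
  by split=> //; exact: openT.
have -> : (fun s : R => (s - t)^-1 *: rsubmx (c x0 - c x0)) = fun=> 0.
  by apply/funext => s; rewrite subrr raddf0 scaler0.
exact: cvg_cst.
Qed.

Lemma tangential_transverse (c : chart M (p + q)) (mu : R -> M) :
  fatlas F c -> tangential_path F mu ->
  (forall t, 0 <= t <= 1 -> chart_dom c (mu t)) ->
  rsubmx (c (mu 0)) = rsubmx (c (mu 1)).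
Proof.
move=> cF [_ tmu] cmu; apply/rowP => j.
apply: (@zero_derivative_segment R (fun t => rsubmx (c (mu t)) 0 j)) => t t01.
have := tmu c t cF t01 (cmu t t01).
set f := (X in X @ _ --> _) => fcv.
have -> : (fun s : R => (s - t)^-1 * (rsubmx (c (mu s)) 0 j - rsubmx (c (mu t)) 0 j)) =
    (fun A : 'rV[R]_q => A 0 j) \o f.
  by apply/funext => s; rewrite /f /= !mxE.
have := @continuous_cvg _ _ _ _ _ f (fun A : 'rV[R]_q => A 0 j) 0
  (@coord_continuous _ _ _ _ _ _) fcv.
by rewrite mxE; apply; typeclasses eauto.
Qed.

(** Tube lemma: the segment is compact, and near each of its points [H] coincides with a continuous
    map [g] defined on an open set. *)
Lemma homotopy_tube m (U : set (euclidean (R := R) m)) (H : euclidean m -> R -> M)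
    (x : euclidean (R := R) m) (D : set M) :
  open_nbhs x U -> smooth_homotopy U H -> open D ->
  (forall t, 0 <= t <= 1 -> D (H x t)) ->
  \forall y \near x, U y /\ forall t, 0 <= t <= 1 -> D (H y t).
Proof.
move=> [oU Ux] sH oD Dx.
have cid : charts (euclidean (R := R) m) (@id_chart R m).
  by move=> c ->; exact: id_chart_compatible.
have tube : near_covering `[(0 : R), 1].
  by apply/compact_near_coveringP; exact: segment_compact.
have nU : \forall y \near x, U y by exact: open_nbhs_nbhs.
suff : \forall y \near nbhs x, `[(0 : R), 1] `<=` (fun t => 0 <= t <= 1 -> U y -> D (H y t)).
  move=> h; apply: filterS2 nU h => y Uy h; split=> // t t01.
  by apply: h => //=; rewrite in_itv.
apply: tube => t0; rewrite /= in_itv /= => t01.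
pose z0 : 'rV[R]_(m + 1) := row_mx x (const_mx t0).
have Az (y : 'rV[R]_m) (t : R) : U y -> 0 <= t <= 1 ->
   [set z : 'rV[R]_(m + 1) | (@id_chart R m @` (chart_dom (@id_chart R m) `&` U)) (lsubmx z) /\
      0 <= rsubmx z 0 0 <= 1] (row_mx y (const_mx t)).
  by move=> Uy ty /=; rewrite row_mxKl row_mxKr mxE; split=> //; exists y.
have [V [g [[oV Vz0] sg gH]]] := sH _ cid z0 (Az _ _ Ux t01).
have HE y t : U y -> 0 <= t <= 1 -> V (row_mx y (const_mx t)) ->
    H y t = g (row_mx y (const_mx t)).
  move=> Uy ty Vy; rewrite -gH //; last exact: Az.
  by rewrite /= row_mxKl row_mxKr mxE.
have : \forall z \near z0, V z /\ D (g z).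
  apply: filterI; first exact: open_nbhs_nbhs.
  apply: (smooth_to_continuous sg Vz0); apply: open_nbhs_nbhs; split=> //.
  by rewrite -HE //; exact: Dx.
move=> /nbhs_ballP[e /= e0 eV].
exists (ball t0 e, ball (x : 'rV[R]_m) e) => /=.
  by split; exact: nbhsx_ballx.
move=> [t y] /= [te ye] ty Uy.
have [Vz Dz] : V (row_mx y (const_mx t)) /\ D (g (row_mx y (const_mx t))).
  apply: eV; split=> // i j; rewrite !mxE; case: splitP => k _.
    by case: ye => _; apply.
  by rewrite !mxE.
by rewrite HE.
Qed.

Hypothesis hF : Q_foliation F.

Lemma Q_pull_same_point m (V : set 'rV[R]_m) (f g : 'rV[R]_m -> M) x r
    (w : mform_family M r) v :
  open_nbhs x V -> smooth_to V f -> smooth_to V g ->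
  (forall y, V y -> leaf_proj F (f y) = leaf_proj F (g y)) -> f x = g x ->
  basic_set F w -> pull w f x v = pull w g x v.
Proof.
move=> nV sf sg fg fgx bw.
have mw : is_mform w by case: bw.
(* The tubular property is about maps defined on a whole manifold, so V is
   replaced by R^m by means of rho, which is tangent to the identity at x. *)
have [rho [srho rhoV rhox rhoJ]] := retraction nV.
have pull_rho h : smooth_to V h -> pull w h x v = pull w (h \o rho) x v.
  move=> sh; rewrite (pull_comp v mw openT (fun y _ => rhoV y) sh srho (I : setT x)).
  by rewrite rhox rhoJ mulmx1.
rewrite (pull_rho f sf) (pull_rho g sg).
have sfr := smooth_to_comp openT (fun y _ => rhoV y) sf srho.
have sgr := smooth_to_comp openT (fun y _ => rhoV y) sg srho.
have frx : (f \o rho) x = f x by rewrite /= rhox.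
have grx : (g \o rho) x = f x by rewrite /= rhox -fgx.
have [U [H [[oU Ux] sH H01 Hx HT]]] := hF (X := euclidean m) (x := x)
  (euclidean_smooth_map sfr) (euclidean_smooth_map sgr) (fun y => fg _ (rhoV y))
  (constant_tangential (f x)) (esym frx) (esym grx).
have [c cF cx] := fatlas_cover F (f x).
pose c' : chart_of M := exist _ c (fatlas_charts cF).
apply: (@transverse_eq_pull _ _ _ _ F _ _ _ setT _ _ c' _ _ bw sfr sgr I cF).
- by rewrite frx.
- by rewrite grx.
(* Over [x] the homotopy is the constant path, so over nearby [y] it stays in the chart [c], where
   tangential paths keep their transverse coordinate. *)
have Dx t : 0 <= t <= 1 -> chart_dom c (H x t) by move=> /Hx ->.
have := homotopy_tube (conj oU Ux) sH (chart_dom_open c) Dx.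
apply: filterS => y [Uy cH]; have [H0 H1] := H01 y Uy.
by rewrite -H0 -H1; exact: tangential_transverse cF (HT y Uy) cH.
Qed.

(** Sliding [f] along its leaf until its value at [x] is [g x] reduces this to the case of a common
    value. *)
Lemma Q_pull m (V : set 'rV[R]_m) (f g : 'rV[R]_m -> M) x r
    (w : mform_family M r) v :
  open_nbhs x V -> smooth_to V f -> smooth_to V g ->
  (forall y, V y -> leaf_proj F (f y) = leaf_proj F (g y)) ->
  basic_set F w -> pull w f x v = pull w g x v.
Proof.
move=> nV sf sg fg bw.
have fgx : same_leaf F (f x) (g x).
  have /eqmodP/asboolP : leaf_proj F (f x) = leaf_proj F (g x) by apply: fg; case: nV.
  by [].
have [V' [f' [nV' V'V sf' f'x [lf pf]]]] := same_leaf_germ nV sf fgx.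
rewrite (pf r w v bw).
have sg' : smooth_to V' g by apply: smooth_to_sub V'V sg; case: nV'.
refine (Q_pull_same_point v nV' sf' sg' _ f'x bw) => y V'y.
by rewrite -lf // fg //; exact: V'V.
Qed.

End TubularProperty.

(** * Forms on the space of leaves *)

Section LeafSpaceForms.
Context {R : realType}.
Variables (p q : nat) (M : @manifold R (p + q)) (F : foliation M).
Local Notation D := (quotient_diffeology F).
Local Notation consmx := (@col_mx _ 1 _ _).
Local Notation plot_forms := (@form_family R (plot_of D) (fun a => plot_dim (sval a))).
Local Notation domain a := (@pdom R _ D a).

Lemma lift_plot_subproof m (V : set 'rV[R]_m) (oV : open V) (f : 'rV[R]_m -> M) :
  smooth_to V f -> D (Plot oV (leaf_proj F \o f)).
Proof. by move=> sf t Vt; exists V, f; split. Qed.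

Definition lift_plot m (V : set 'rV[R]_m) (oV : open V) (f : 'rV[R]_m -> M)
  (sf : smooth_to V f) : plot_of D :=
  exist _ (Plot oV (leaf_proj F \o f)) (lift_plot_subproof (oV := oV) sf).

Definition chart_plot (c : chart_of M) : plot_of D :=
  lift_plot (open_chart_img (sval c)) (@chart_inv_smooth_to _ _ _ c).

Definition is_lift (a : plot_of D) V (f : 'rV[R]_(plot_dim (sval a)) -> M) : Prop :=
  [/\ open V, V `<=` domain a, smooth_to V f &
      forall s, V s -> (sval a : plot _) s = leaf_proj F (f s)].

Lemma lift_exists (a : plot_of D) t : domain a t ->
  exists f, exists2 V, is_lift V f & V t.
Proof.
move=> at_; have [V [f [[oV Vt] Va sf af]]] := svalP a t at_.
by exists f, V.
Qed.

Lemma plaque_chart_inv c z z' : fatlas F c -> chart_img c z -> chart_img c z' ->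
  rsubmx z = rsubmx z' -> leaf_proj F (chart_inv c z) = leaf_proj F (chart_inv c z').
Proof.
move=> cF cz cz' zz; apply/eqmodP/asboolP; apply: Relation_Operators.rst_step.
by exists c => //; split; rewrite ?chart_invK //; exact: chart_inv_dom.
Qed.

Definition forms_on_charts r (w : plot_forms r) :
  mform_family M r := fun c => w (chart_plot c).

Arguments forms_on_charts {r} w c : rename.

Lemma forms_on_charts_linear r : linear (@forms_on_charts r).
Proof. by move=> a u v; apply: functional_extensionality_dep => c. Qed.

Lemma forms_on_charts_diff r (w : plot_forms r) :
  mform_diff (forms_on_charts w) =
  forms_on_charts (family_diff (@pdom _ _ D) w).
Proof. by []. Qed.

(** * From forms on the space of leaves to basic forms *)

Section DForms.
Variable r : nat.
Implicit Types (w : plot_forms r).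

Lemma dform_restrict w (a : plot_of D) V f (oV : open V) (sf : smooth_to V f) t v :
  dform_set w -> is_lift (a := a) V f -> V t -> w a t v = w (lift_plot oV sf) t v.
Proof.
move=> [_ cw] [_ Va _ af] Vt.
rewrite (cw a (lift_plot oV sf) idfun) //; first by rewrite pullback_id.
split=> //; first exact: smooth_id.
by move=> s Vs; rewrite af.
Qed.

Lemma dform_lift_chart w m (V : set 'rV[R]_m) f (oV : open V) (sf : smooth_to V f)
    (c : chart_of M) t v :
  dform_set w -> V `<=` f @^-1` chart_dom (sval c) -> smooth V (sval c \o f) -> V t ->
  w (lift_plot oV sf) t v = pullback (sval c \o f) (forms_on_charts w c) t v.
Proof.
move=> [_ cw] Vc scf Vt.
rewrite (cw (chart_plot c) (lift_plot oV sf) (sval c \o f)) //; split=> //.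
- by move=> s /Vc; exact: chart_img_map.
- by move=> s /Vc cs; rewrite /= chart_mapK.
Qed.

(** Near [t] the plot is [pi o c^-1] composed with [c \o f], so compatibility expresses [w a]
    through the chart plots. *)
Lemma dform_pull w (a : plot_of D) V f t v :
  dform_set w -> is_lift (a := a) V f -> V t ->
  w a t v = pull (forms_on_charts w) f t v.
Proof.
move=> dw [oV Va sf af] Vt; set c := chart_at (f t).
have [W0 [[oW0 W0t] W0c sW0]] := smooth_to_chart sf Vt (svalP c) (chart_atP (f t)).
have oW : open (W0 `&` V) by exact: openI.
have sfW : smooth_to (W0 `&` V) f by apply: smooth_to_sub sf => // y [].
have lW : is_lift (a := a) (W0 `&` V) f.
  by split=> // s [_ Vs]; [exact: Va|exact: af].
rewrite (dform_restrict oW sfW v dw lW) // (dform_lift_chart (c := c)) //.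
- by move=> y [/W0c].
- by apply: smooth_sub sW0 => y [].
Qed.

Lemma forms_on_charts_mform w : dform_set w -> is_mform (forms_on_charts w).
Proof.
move=> dw; split=> [c|c c' x v o].
  by case: dw => /(_ (chart_plot c)).
have oW := overlap_open (sval c) (sval c').
have sW : smooth_to (overlap (sval c) (sval c')) (chart_inv (sval c)).
  by apply: smooth_to_sub (@chart_inv_smooth_to _ _ _ c) => // y /overlapP[].
have lW : is_lift (a := chart_plot c) (overlap (sval c) (sval c')) (chart_inv (sval c)).
  by split=> // y /overlapP[].
apply: etrans (@dform_restrict w (chart_plot c) _ _ oW sW x v dw lW o) _.
apply: (@dform_lift_chart w _ _ _ oW sW c' x v dw) => //.
- by move=> y /overlapP[].
- exact: transition_smooth (svalP c) (svalP c').
Qed.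

Lemma dform_vertical w (c : chart_of M) z i u :
  dform_set w -> fatlas F (sval c) -> cimg c z -> rsubmx (row i u) = 0 ->
  forms_on_charts w c z u = 0.
Proof.
move=> dw cF cz ui; have [P [T [oP cP oT PT]]] := fatlas_product cF.
have cE y : cimg c y <-> P (lsubmx y) /\ T (rsubmx y) by rewrite /cimg PT.
have [Pz Tz] : P (lsubmx z) /\ T (rsubmx z) by apply/cE.
(* The plot of the chart c is unchanged by composition with h, which collapses
   the plaques. *)
pose h (y : 'rV[R]_(p + q)) : 'rV[R]_(p + q) := row_mx (lsubmx z) (rsubmx y).
have sh : smooth (cimg c) h.
  move=> k; apply: Ck_row => [|j]; first exact: open_chart_img.
  case: (split_ordP j) => l ->.
    have -> : (fun y => h y 0 (lshift q l)) = fun=> lsubmx z 0 l.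
      by apply/funext => y; rewrite /h row_mxEl.
    exact: Ck_cst.
  have -> : (fun y => h y 0 (rshift p l)) = fun y => y 0 (rshift p l).
    by apply/funext => y; rewrite /h row_mxEr mxE.
  exact: Ck_coord (open_chart_img (sval c)) (@smooth_id R _ (cimg c) k).
have ch y : cimg c y -> cimg c (h y).
  by move=> /cE[_ Ty]; apply/cE; rewrite row_mxKl row_mxKr.
have hz : h z = z by rewrite /h hsubmxK.
have fac : plot_factor (a := sval (chart_plot c)) (b := sval (chart_plot c)) h.
  split=> // y cy; apply: (plaque_chart_inv cF cy (ch y cy)).
  by rewrite row_mxKr.
have [fw cw] := dw.
apply: etrans (cw (chart_plot c) (chart_plot c) h fac z u cz) _; rewrite /pullback hz.
have [mw _ _ _] := fw (chart_plot c).
(* Since [h] depends on the transverse coordinate only, its derivative along the vertical row [i] is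
   0. *)
apply: (multilinear0 (i := i) (mw z cz)).
apply: etrans (row_mul_jacobian u i (smooth_differentiable sh cz)) _.
apply: derive_locally_constant.
apply: filterS (near_line (row i u) (open_chart_img (sval c)) cz) => s _; rewrite /h.
by rewrite linearP /= ui scaler0 add0r.
Qed.

End DForms.

(** Tangency is a condition in foliated charts, so the value is transported to one around the
    point. *)
Lemma forms_on_charts_interior r (w : plot_forms r) X (c : chart_of M) x v :
  dform_set w -> tangent_vector_field F X -> cimg c x ->
  interior (X c) (forms_on_charts w c) x v = 0.
Proof.
case: r w v => [//|s] w v dw [[_ chX] tX] cx.
have [_ cw] := forms_on_charts_mform dw.
have [c0 cF cx0] := fatlas_cover F (chart_inv (sval c) x).
pose c' : chart_of M := exist _ c0 (fatlas_charts cF).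
have o : overlap (sval c) (sval c') x by apply/overlapP.
rewrite /interior (cw c c' x _ o) /pullback.
have tx : cimg c' (transition (sval c) (sval c') x) by exact: chart_img_map.
apply: (dform_vertical (i := 0)) => //.
by rewrite row_mul row0_col_mx -(chX c c' x o) tX.
Qed.

(** The condition on the differential is immediate where this is applied: it is 0 for a cocycle, and
    for a primitive of a cocycle it is that cocycle. *)
Lemma forms_on_charts_basic r (w : plot_forms r) :
  dform_set w -> dform_set (family_diff (@pdom _ _ D) w) ->
  basic_set F (forms_on_charts w).
Proof.
move=> dw ddw; split; first exact: forms_on_charts_mform.
move=> X tX c x cx; split=> v; first exact: forms_on_charts_interior.
by rewrite forms_on_charts_diff; exact: forms_on_charts_interior.
Qed.

Hypothesis hF : Q_foliation F.

(** A lift is chosen separately at each point [t]; the value 0 off the domain is the one required by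
    [is_form]. *)
Definition forms_on_plots r (u : mform_family M r) :
    plot_forms r :=
  fun a t v =>
    match pselect (domain a t) with
    | left h => pull u (sval (cid (lift_exists h))) t v
    | right _ => 0
    end.

Arguments forms_on_plots {r} u a t v : rename.

(** * From basic forms to forms on the space of leaves *)

Section BasicForms.
Variable r : nat.
Implicit Types (u : mform_family M r).

(** Any two lifts have the same projection on the intersection of their domains, so [Q_pull] makes
    the chosen one irrelevant. *)
Lemma forms_on_plotsE u (a : plot_of D) V f t v :
  basic_set F u -> is_lift (a := a) V f -> V t ->
  forms_on_plots u a t v = pull u f t v.
Proof.
move=> bu [oV Va sf af] Vt; rewrite /forms_on_plots.
case: pselect => [h|]; last by move=> n; exfalso; apply/n/Va.
case: (cid _) => /= g [W [oW Wa sg ag] Wt].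
apply: (Q_pull hF (V := W `&` V)) => //.
- by split; [exact: openI|split].
- by apply: smooth_to_sub sg; [exact: openI|move=> y []].
- by apply: smooth_to_sub sf; [exact: openI|move=> y []].
- by move=> y [Wy Vy]; rewrite -ag // -af.
Qed.

Lemma forms_on_plots_out u (a : plot_of D) t v :
  ~ domain a t -> forms_on_plots u a t v = 0.
Proof. by rewrite /forms_on_plots; case: pselect. Qed.

(** One lift and one chart serve on a whole neighbourhood of [t], so that smoothness and the
    differential can be read off an ordinary pullback. *)
Lemma forms_on_plots_local u (a : plot_of D) t : basic_set F u -> domain a t ->
  exists f V, [/\ is_lift (a := a) V f, V t, smooth V (sval (chart_at (f t)) \o f),
    forall s, V s -> cimg (chart_at (f t)) ((sval (chart_at (f t)) \o f) s) &
    forall s v, V s -> forms_on_plots u a s v =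
      pullback (sval (chart_at (f t)) \o f) (u (chart_at (f t))) s v].
Proof.
move=> bu at_; have [f [V [oV Va sf af] Vt]] := lift_exists at_.
set c := chart_at (f t).
have [W0 [[oW0 W0t] W0c sW0]] := smooth_to_chart sf Vt (svalP c) (chart_atP (f t)).
have oW : open (W0 `&` V) by exact: openI.
have sfW : smooth_to (W0 `&` V) f by apply: smooth_to_sub sf => // y [].
have lW : is_lift (a := a) (W0 `&` V) f.
  by split=> // s [_ Vs]; [exact: Va|exact: af].
exists f, (W0 `&` V); split=> //.
- by apply: smooth_sub sW0 => y [].
- by move=> s [/W0c cs _]; exact: chart_img_map.
- move=> s v Ws; rewrite (forms_on_plotsE v bu lW Ws).
  apply: (pullE (V := W0 `&` V)) => //; first by case: bu.
  by case: Ws => /W0c.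
Qed.

Lemma forms_on_plots_dform u : basic_set F u -> dform_set (forms_on_plots u).
Proof.
move=> bu; split=> [a|a b h [sh hab bh] t v bt].
  split=> [t at_|t at_|v|t v]; last exact: forms_on_plots_out.
  - have [f [V [lV Vt sV cV E]]] := forms_on_plots_local bu at_.
    have [mu _ _ _] := basic_is_form (chart_at (f t)) bu.
    have -> : forms_on_plots u a t = pullback (sval (chart_at (f t)) \o f) (u (chart_at (f t))) t.
      by apply/funext => v; exact: E.
    by apply: pullback_multilinear; apply: mu; exact: cV.
  - have [f [V [lV Vt sV cV E]]] := forms_on_plots_local bu at_.
    have [_ au _ _] := basic_is_form (chart_at (f t)) bu.
    have -> : forms_on_plots u a t = pullback (sval (chart_at (f t)) \o f) (u (chart_at (f t))) t.
      by apply/funext => v; exact: E.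
    by apply: pullback_alternating; apply: au; exact: cV.
  - apply: smooth_local => t at_.
    have [f [V [[oV Va sf af] Vt sV cV E]]] := forms_on_plots_local bu at_.
    exists V; split; first by split.
    apply: (smooth_eq oV) (pullback_smooth oV (open_chart_img _) sV cV (basic_is_form _ bu) v).
    by move=> s Vs; rewrite E.
(* Compatibility: if [f] lifts [a] then [f \o h] lifts [b]. *)
have [f [V [oV Va sf af] Vt]] := lift_exists (hab t bt).
have ob : open (domain b) by exact: plot_open.
pose W := domain b `&` h @^-1` V.
have oW : open W by exact: open_preimage.
have shW : smooth W h by apply: smooth_sub sh => y [].
have lW : is_lift (a := b) W (f \o h).
  split=> //; first by move=> y [].
    by apply: (smooth_to_comp oW) sf shW => y [].
  by move=> s [bs Vs]; rewrite bh // af.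
rewrite (forms_on_plotsE v bu lW) // /pullback.
rewrite (forms_on_plotsE (V := V) (f := f) _ bu) //.
apply: (pull_comp (V := V) (U := W)) => //; first by case: bu.
by move=> y [].
Qed.

(** The map c^-1 lifts the plot of [c], and its expression in the chart [c] is the identity. *)
Lemma forms_on_plotsK u : basic_set F u -> forms_on_charts (forms_on_plots u) = u.
Proof.
move=> bu; apply: functional_extensionality_dep => c; apply/funext => z; apply/funext => v.
have [cz|ncz] := pselect (cimg c z); last first.
  have [_ _ _ u0] := basic_is_form c bu.
  by rewrite u0 //; exact: forms_on_plots_out.
have sc := @chart_inv_smooth_to _ _ _ c.
have lc : is_lift (a := chart_plot c) (cimg c) (chart_inv (sval c)).
  by split=> //; exact: open_chart_img.
apply: etrans (forms_on_plotsE (a := chart_plot c) v bu lc cz) _.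
have mu : is_mform u by case: bu.
rewrite (pullE v mu sc cz (chart_inv_dom cz)).
have E : \forall y \near z, idfun y = (sval c \o chart_inv (sval c)) y.
  apply: filterS (open_nbhs_nbhs (conj (open_chart_img (sval c)) cz)) => y cy /=.
  by rewrite chart_invK.
have did := smooth_differentiable (@smooth_id R _ (cimg c)) cz.
by rewrite -(near_eq_pullback (u c) v E did) pullback_id.
Qed.

Lemma forms_on_plots_diff u (a : plot_of D) t v : basic_set F u -> domain a t ->
  exists f V, [/\ is_lift (a := a) V f, V t &
    ext_diff (domain a) (forms_on_plots u a) t v = pull (mform_diff u) f t v].
Proof.
move=> bu at_; have [f [V [lV Vt sV cV E]]] := forms_on_plots_local bu at_.
have [oV Va sf af] := lV.
exists f, V; split=> //.
transitivity (ext_diff V (pullback (sval (chart_at (f t)) \o f) (u (chart_at (f t)))) t v).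
  apply: near_eq_ext_diff => // v'.
  by apply: filterS (open_nbhs_nbhs (conj oV Vt)) => s Vs; exact: E.
exact: ext_diff_pullback oV (open_chart_img _) sV cV (basic_is_form _ bu) Vt.
Qed.

End BasicForms.

Lemma forms_on_charts_inj r (w w' : plot_forms r) :
  dform_set w -> dform_set w' -> forms_on_charts w = forms_on_charts w' -> w = w'.
Proof.
move=> dw dw' ww'; apply: functional_extensionality_dep => a.
apply/funext => t; apply/funext => v; have [at_|nat_] := pselect (domain a t).
  have [f [V lV Vt]] := lift_exists at_.
  by rewrite (dform_pull v dw lV Vt) (dform_pull v dw' lV Vt) ww'.
have [fw _] := dw; have [fw' _] := dw'.
by have [_ _ _ ->] := fw a => //; have [_ _ _ ->] := fw' a.
Qed.

(** In degree 0 coboundaries are 0 and injectivity suffices. In higher degree primitives are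
    transported by [forms_on_charts] one way and by [forms_on_plots] the other. *)
Lemma forms_on_charts_coboundary r (z : subspace_type (cocycles (deRham_complex D) r))
    (y : subspace_type (cocycles (basic_complex F) r)) :
  subspace_val y = forms_on_charts (subspace_val z) ->
  coboundaries (deRham_complex D) r z <-> coboundaries (basic_complex F) r y.
Proof.
move=> yz; have := subspace_valP z; rewrite inE => -[dz z0].
have := subspace_valP y; rewrite inE => -[by_ y0].
case: r z y yz dz z0 by_ y0 => [|s] z y yz dz z0 by_ y0; split.
- move=> zE; have {}zE : z = 0 := zE.
  by apply: val_inj; apply: etrans yz _; rewrite zE.
- move=> yE; have {}yE : y = 0 := yE.
  apply: val_inj; apply: forms_on_charts_inj dz (dform0 _ _) _.
  by rewrite -[LHS]yz yE.
- move=> [u du zu]; exists (forms_on_charts u).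
    apply: forms_on_charts_basic du _.
    by rewrite -[family_diff _ _]zu.
  by rewrite yz zu.
(* Along a local lift both sides are the pullback of [y], which is du. *)
- move=> [u bu yu]; exists (forms_on_plots u); first exact: forms_on_plots_dform.
  apply: functional_extensionality_dep => a; apply/funext => t; apply/funext => v.
  have [at_|nat_] := pselect (domain a t); last first.
    have [fz _] := dz; have [_ _ _ ->] := fz a => //.
    by rewrite /= /family_diff /ext_diff asboolF.
  have [f [V [lV Vt E]]] := forms_on_plots_diff v bu at_.
  apply: etrans (dform_pull v dz lV Vt) _; rewrite -yz yu.
  exact: esym E.
Qed.

End LeafSpaceForms.

Theorem theorem5p1 (R : realType) (p q : nat) (M : @manifold R (p + q))
    (F : foliation M) (hF : Q_foliation F) (r : nat) :
  exists f : {linear cohomology (deRham_complex (quotient_diffeology F)) r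
                  -> cohomology (basic_complex F) r},
    bijective f.
Proof.
pose L := GRing.isLinear.Build R _ _ *:%R (@forms_on_charts R p q M F r)
  (@forms_on_charts_linear R p q M F r).
pose phi : {linear ambient (deRham_complex (quotient_diffeology F)) r ->
  ambient (basic_complex F) r} := HB.pack (@forms_on_charts R p q M F r) L.
apply: (@cohomology_iso R (deRham_complex (quotient_diffeology F)) (basic_complex F) r phi).
- move=> z [dz z0].
  have dz' : dform_set (family_diff (@pdom _ _ (quotient_diffeology F)) z).
    by rewrite [family_diff _ _]z0; exact: dform0.
  split; first exact: forms_on_charts_basic.
  rewrite -[LHS]/(forms_on_charts (family_diff (@pdom _ _ (quotient_diffeology F)) z)).
  by rewrite [family_diff _ _]z0.
- exact: forms_on_charts_coboundary.
- move=> y [by_ y0]; exists (forms_on_plots y); last exact: forms_on_plotsK.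
  split; first exact: forms_on_plots_dform.
  apply: functional_extensionality_dep => a; apply/funext => t; apply/funext => v.
  have [at_|nat_] := pselect (@pdom R _ (quotient_diffeology F) a t); last first.
    by rewrite /= /family_diff /ext_diff asboolF.
  (* The differential of the preimage is locally the pullback of dy, which is 0. *)
  have [f [V [_ _ E]]] := forms_on_plots_diff hF v by_ at_.
  apply: etrans E _.
  by rewrite [mform_diff _]y0.
Qed.
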